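(* Let $\mathbb{K}$ be a commutative partially ordered ring, $V$ a partially ordered Jordan algebra (poJa) over $\mathbb{K}$ with symmetric cone $\Omega$, $X=X(V)\supset V$ its Jordan geometry with its canonical partial cyclic order $R$, and for $a,b\in X$ let $]a,b[\,=\{x\in X\mid(a,x,b)\in R\}$. Let $(a,b)\in X^2$ be a transversal pair. Then the affine image $]a,b[\,\cap V$ of the interval $]a,b[$ is as follows: (1) (parabolic image) If $a\in V$ and $b=\infty$, then $]a,b[\,=a+\Omega$. If $b\in V$ and $a=\infty$, then $]a,b[\,=b-\Omega$. (2) (elliptic image) If $a,b\in V$ and $a<b$, then $]a,b[\,=(a+\Omega)\cap(b-\Omega)$, and this is a convex subset of $V$. (3) (hyperbolic image) If $a,b\in V$ and $b<a$, then $(a+\Omega)\cup(b-\Omega)\subset\,]a,b[\,\cap V$, but equality does not hold in general (there exist a poJa $V$ and $a,b\in V$ with $b<a$ for which it fails). If $a,b\in V$ and not $a<b$, then $]a,b[$ is in general not contained in $V$, and $]a,b[\,\cap V$ is in general not a convex subset of $V$ (there exist a poJa $V$ and a transversal pair $a,b\in V$ with not $a<b$ for which $]a,b[\,\not\subset V$, and likewise for which $]a,b[\,\cap V$ is not convex).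
   Context: **Ordered rings and modules.** A partial order $<$ means an asymmetric transitive relation. A commutative partially ordered ring (por) is a commutative unital ring $\mathbb{K}$ with a partial order $<$ such that $0<1$; $a<b\Rightarrow a+c<b+c$; and ($0<b$ and $a<c$) $\Rightarrow ba<bc$. A partially ordered $\mathbb{K}$-module is a $\mathbb{K}$-module $V$ with a partial order $<$ such that $a<b\Rightarrow a+c<b+c$, and ($0<\beta\in\mathbb{K}$, $a<c$) $\Rightarrow\beta a<\beta c$. A subset $S\subset V$ is convex if $(1-t)a+tb\in S$ for all $a,b\in S$ and all $t\in\mathbb{K}$ with $0<t<1$. **Jordan algebras.** A (unital, quadratic) Jordan algebra over $\mathbb{K}$ is a $\mathbb{K}$-module $V$ with an element $e\neq0$ and a quadratic map $Q:V\to\mathrm{End}_{\mathbb{K}}(V)$, $a\mapsto Q_a$, such that, with $D_{a,x}(b)=(Q_{a+b}-Q_a-Q_b)(x)$, the identities $Q_e=\mathrm{id}_V$, $Q_{Q_a(b)}=Q_aQ_bQ_a$ and $Q_aD_{x,a}=D_{a,x}Q_a$ hold in all scalar extensions of $\mathbb{K}$. An element $a$ is invertible if $Q_a$ is bijective; then $a^{-1}:=Q_a^{-1}(a)$. The set of invertible elements is $V^\times$. **poJa.** A partially ordered Jordan algebra over a commutative por $\mathbb{K}$ is a unital Jordan algebra $V$ which is a partially ordered $\mathbb{K}$-module such that: $e>0$; every $a>0$ lies in $V^\times$; and for all $a\in V$, $b\in V^\times$: $a>0\Rightarrow Q_b(a)>0$. Its symmetric cone is $\Omega=\{a\in V\mid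 a>0\}$. **Jordan geometry $X(V)$.** Let $L=V\oplus L_0\oplus V$ (the Kantor–Koecher–Tits Lie algebra of $V$), where $L_0\subset\mathrm{End}(V)\times\mathrm{End}(V)$ is spanned by $(\mathrm{id},-\mathrm{id})$ and all $(D_{x,y},-D_{y,x})$, $x,y\in V$. Write $v^+$, $v^-$ for $v$ in the first, resp. last summand. The bracket is the commutator on $L_0$, $[(A,B),u^+]=(Au)^+$, $[(A,B),v^-]=(Bv)^-$, $[x^+,y^-]=-(D_{x,y},-D_{y,x})$, and $[u^+,v^+]=0=[u^-,v^-]$. The swap $\theta(u^++(A,B)+v^-)=v^++(B,A)+u^-$ is an automorphism of $L$. For $v\in V$ let $t_v\in\mathrm{Aut}(L)$ be the automorphism ''$\exp(\mathrm{ad}\,v^+)$'': $t_v(u^+)=u^+$, $t_v(A,B)=(A,B)-(Av)^+$, $t_v(y^-)=y^-+[v^+,y^-]+(Q_vy)^+$; and let $\tilde t_v=\theta t_v\theta$. Let $G_0=G_0(X)$ be the subgroup of $\mathrm{Aut}(L)$ generated by all $t_v,\tilde t_w$ ($v,w\in V$). For $y\in V^\times$, the pair $(Q_y,Q_y^{-1})$ defines an element of $G_0$ acting by $u^++(A,B)+v^-\mapsto(Q_yu)^++(Q_yAQ_y^{-1},Q_y^{-1}BQ_y)+(Q_y^{-1}v)^-$. Let $P\subset G_0$ be the subgroup generated by all $\tilde t_v$ ($v\in V$) and all these elements (it is the semidirect product of $\tilde t_V$ with the inner structure group $\mathrm{Istr}(V)=\langle Q_y\mid y\in V^\times\rangle$).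 Then $X=X(V)=G_0/P$ with its $G_0$-action, $o=P$ is the origin, $V$ is identified with the subset $\{t_v.o\mid v\in V\}$ of $X$ via $v\mapsto t_v.o$ (so $0=o$ and $t_v$ extends the translation by $v$), and $\infty=w.o$, where $w=t_e\tilde t_{-e}t_e$ (which extends $x\mapsto-x^{-1}$ on $V^\times$). **Transversality.** A pair $(a,b)\in X^2$ is transversal iff $(a,b)=(g(o),g(\infty))$ for some $g\in G_0$. **Cyclic order.** A partial cyclic order on a set $M$ is a subset $R\subset M^3$ such that: $(a,b,c)\in R\Rightarrow(b,c,a)\in R$; $(a,b,c)\in R\Rightarrow(c,b,a)\notin R$; and $(a,b,c),(a,c,d)\in R\Rightarrow(a,b,d)\in R$. The canonical partial cyclic order of $X=X(V)$ is $R=\{(a,x,b)\in X^3\mid\exists g\in G_0:\ g(a)=o,\ g(b)=\infty,\ g(x)\in\Omega\}$ (this is indeed a $G_0$-invariant partial cyclic order).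
   Formalization: The point ∞ is w.o with w = t_e t̃_e t_e, the element that extends x ↦ -x^{-1}; under the stated bracket conventions the formula t_e t̃_{-e} t_e has a sign slip (for V = K it sends 0 to 3/2, which makes part (1) false). *)

(* Defs.v *)
From HB Require Import structures.
From mathcomp Require Import all_boot all_order all_algebra.
From mathcomp Require Import boolp classical_sets functions.

Set Implicit Arguments.
Unset Strict Implicit.
Unset Printing Implicit Defensive.

Import Order.TTheory GRing.Theory.
Local Open Scope classical_set_scope.
Local Open Scope ring_scope.

(* The library has no join of rings and partial orders below `numDomainType`,
   and none can be added after it. *)
HB.mixin Record hasStrictOrder T := {
  slt : T -> T -> Prop ;
  slt_asym : forall a b, slt a b -> ~ slt b a ;
  slt_trans : forall a b c, slt a b -> slt b c -> slt a c }.

#[short(type="strictOrderType")]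
HB.structure Definition StrictOrder := { T of hasStrictOrder T }.

Notation "x <o y" := (slt x y) (at level 70, no associativity) : ring_scope.

HB.mixin Record Zmodule_isPoZmodule V of GRing.Zmodule V & StrictOrder V := {
  slt_add2r : forall a b c : V, a <o b -> a + c <o b + c }.

#[short(type="poZmodType")]
HB.structure Definition PoZmodule :=
  { V of Zmodule_isPoZmodule V & GRing.Zmodule V & StrictOrder V }.

HB.mixin Record ComNzRing_isPoRing K of GRing.ComNzRing K & PoZmodule K := {
  poring_lt01 : (0 : K) <o 1 ;
  poring_mul2l : forall a b c : K, (0 : K) <o b -> a <o c -> b * a <o b * c }.

#[short(type="poRingType")]
HB.structure Definition PoRing :=
  { K of ComNzRing_isPoRing K & GRing.ComNzRing K & PoZmodule K }.

HB.mixin Record Lmodule_isPoModule (K : poRingType) V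
    of GRing.Lmodule K V & PoZmodule V := {
  pomod_scale2l : forall (k : K) (a c : V),
    0 <o k -> a <o c -> k *: a <o k *: c }.

#[short(type="poModType")]
HB.structure Definition PoModule (K : poRingType) :=
  { V of Lmodule_isPoModule K V & GRing.Lmodule K V & PoZmodule V }.

Definition convex_set (K : poRingType) (V : lmodType K) (S : set V) : Prop :=
  forall (a b : V) (t : K), S a -> S b -> 0 <o t -> t <o 1 ->
    S ((1 - t) *: a + t *: b).

(* The polarization is symmetric, so linearity in `a` is bilinearity. *)
Definition quadratic_map (K : comPzRingType) (M N : lmodType K) (q : M -> N) :=
  (forall (k : K) (a : M), q (k *: a) = k ^+ 2 *: q a) /\
  (forall b : M, linear (fun a : M => q (a + b) - q a - q b)).

Definition jpolar (K : comPzRingType) (V : lmodType K)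
    (Q : V -> {linear V -> V}) (a x b : V) : V :=
  Q (a + b) x - Q a x - Q b x.

Definition jordan_identities (K : comPzRingType) (V : lmodType K)
    (e : V) (Q : V -> {linear V -> V}) : Prop :=
  [/\ forall x, Q e x = x,
      forall a b x, Q (Q a b) x = Q a (Q b (Q a x)) &
      forall a x y, Q a (jpolar Q x a y) = jpolar Q a x (Q a y)].

(* `iota : V -> W` exhibits the A-module `W` as the scalar extension of the
   K-module `V` along `phi : K -> A`, by the universal property of
   v |-> 1 (x) v : V -> A (x)_K V. *)
Definition scalar_extension (K A : comPzRingType) (phi : {rmorphism K -> A})
    (V : lmodType K) (W : lmodType A) (iota : {linear V -> W | phi \; *:%R}) :=
  forall (U : lmodType A) (f : {linear V -> U | phi \; *:%R}),
    (exists g : {linear W -> U}, forall v, g (iota v) = f v) /\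
    (forall g h : {linear W -> U},
       (forall v, g (iota v) = h (iota v)) -> forall w, g w = h w).

(* On a scalar extension `QW` is the quadratic map extending `jquad`; it is
   unique, because `W` is spanned by the image of `iota`. *)
HB.mixin Record Lmodule_isJordan (K : comPzRingType) V of GRing.Lmodule K V := {
  jone : V ;
  jquad : V -> {linear V -> V} ;
  jone_neq0 : jone != 0 ;
  jquad_quadratic : forall x : V, quadratic_map (fun a => jquad a x) ;
  jordan_scalar_extension :
    forall (A : comPzRingType) (phi : {rmorphism K -> A}) (W : lmodType A)
      (iota : {linear V -> W | phi \; *:%R}) (QW : W -> {linear W -> W}),
    scalar_extension iota ->
    (forall x : W, quadratic_map (fun a => QW a x)) ->
    (forall a x : V, QW (iota a) (iota x) = iota (jquad a x)) ->
    jordan_identities (iota jone) QW }.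

#[short(type="jordanAlgType")]
HB.structure Definition JordanAlg (K : comPzRingType) :=
  { V of Lmodule_isJordan K V & GRing.Lmodule K V }.

Arguments jone {K V} : rename.

Definition jinvertible (K : comPzRingType) (V : jordanAlgType K) (a : V) :=
  bijective (jquad a).

HB.mixin Record Jordan_isPoJordan (K : poRingType) V
    of PoModule K V & JordanAlg K V := {
  poja_one_gt0 : (0 : V) <o jone ;
  poja_gt0_inv : forall a : V, 0 <o a -> jinvertible a ;
  poja_quad_gt0 : forall a b : V, jinvertible b -> 0 <o a -> 0 <o jquad b a }.

#[short(type="poJordanType")]
HB.structure Definition PoJordan (K : poRingType) :=
  { V of Jordan_isPoJordan K V & PoModule K V & JordanAlg K V }.

Definition symmetric_cone (K : poRingType) (V : poJordanType K) : set V :=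
  [set a | 0 <o a].

Arguments symmetric_cone {K} V.

Definition module_span (K : pzRingType) (M : lmodType K) (S : set M) : set M :=
  [set x | exists2 s : seq (K * M), forall p, p \in s -> S p.2 &
           x = \sum_(p <- s) p.1 *: p.2].

Lemma module_span_gen (K : pzRingType) (M : lmodType K) (S : set M) k a :
  S a -> module_span S (k *: a).
Proof.
move=> Sa; exists [:: (k, a)]; last by rewrite big_seq1.
by move=> p; rewrite inE => /eqP ->.
Qed.

Lemma module_spanD (K : pzRingType) (M : lmodType K) (S : set M) a b :
  module_span S a -> module_span S b -> module_span S (a + b).
Proof.
move=> [s hs ->] [t ht ->]; exists (s ++ t); last by rewrite big_cat.
by move=> p; rewrite mem_cat => /orP[/hs|/ht].
Qed.

Lemma module_span_image (K : pzRingType) (M N : lmodType K)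
    (S : set M) (T : set N) (f : M -> N) :
  linear f -> (forall k a, S a -> module_span T (k *: f a)) ->
  forall a, module_span S a -> module_span T (f a).
Proof.
move=> lf ST _ [s hs ->]; have f0 : f 0 = 0.
  by have /eqP := lf 1 0 0; rewrite !scale1r addr0 -subr_eq subrr => /eqP.
elim: s hs => [_|[k a] s IH hs].
  by rewrite big_nil f0; exists [::]; rewrite ?big_nil.
rewrite big_cons /= lf; apply: module_spanD.
  by apply/ST/(hs (k, a)); rewrite mem_head.
by apply: IH => p ps; apply: hs; rewrite inE ps orbT.
Qed.

(* The subgroup generated by a set of permutations of `T`. *)
Inductive generated (T : Type) (S : set (T -> T)) : set (T -> T) :=
| gen_id : generated S idfun
| gen_mem f : S f -> generated S f
| gen_comp f g : generated S f -> generated S g -> generated S (f \o g)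
| gen_inv f g : generated S f -> cancel f g -> cancel g f -> generated S g.

Section JordanGeometry.

Variables (K : comPzRingType) (V : jordanAlgType K).

Local Notation D := (jpolar (@jquad K V)).

Lemma jordan_identitiesP : jordan_identities (jone : V) (@jquad K V).
Proof.
pose idK : {rmorphism K -> K} := idfun.
have idV : linear_for (idK \; *:%R) (idfun : V -> V) by [].
pose m := GRing.isLinear.Build K V V (idK \; *:%R) idfun idV.
pose iota : {linear V -> V | idK \; *:%R} := HB.pack (idfun : V -> V) m.
apply: (@jordan_scalar_extension K V K idK V iota (@jquad K V)) => //.
  move=> U f; split=> [|g h gh w]; last exact: gh.
  have lf : linear f by move=> k a b; rewrite linearP.
  pose mf := GRing.isLinear.Build K V U *:%R f lf.
  by exists (HB.pack (f : V -> U) mf : {linear V -> U}).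
exact: jquad_quadratic.
Qed.

(* The Kantor-Koecher-Tits algebra V + L_0 + V inside the larger module where
   L_0 is replaced by all pairs of maps.  Its bracket enters only through the
   automorphisms `trans v` = exp (ad v^+), via [(A, B), v^+] = (A v)^+ and
   [v^+, y^-] = - (D v y, - D y v). *)
Definition kkt_ambient : lmodType K := (V * ((V -> V) * (V -> V)) * V)%type.

Definition kkt_zero : set ((V -> V) * (V -> V)) :=
  module_span ([set (idfun, - idfun)] `|`
               [set z | exists x y, z = (D x y, - D y x)]).

Definition kkt_set : set kkt_ambient := [set z | kkt_zero z.1.2].

Definition kkt : Type := kkt_set.

Definition swap_fun (z : kkt_ambient) : kkt_ambient :=
  let: (u, (A, B), v) := z in (v, (B, A), u).

Definition trans_fun (v : V) (z : kkt_ambient) : kkt_ambient :=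
  let: (u, (A, B), y) := z in
  (u - A v + jquad v y, (A - D v y, B + D y v), y).

Definition quad_fun (y : V) (Qinv : V -> V) (z : kkt_ambient) : kkt_ambient :=
  let: (u, (A, B), v) := z in
  (jquad y u, (jquad y \o A \o Qinv, Qinv \o B \o jquad y), Qinv v).

Lemma swap_fun_subproof (z : kkt) : swap_fun (val z) \in kkt_set.
Proof.
have := set_valP z; case: (val z) => [[u [A B]] v].
rewrite inE /kkt_set /= /kkt_zero.
apply: (module_span_image (f := fun T => (T.2, T.1))) => [k [a b] [c d]//|].
move=> k _ [->|[x [y ->]]]; rewrite -[k]opprK scaleNr -scalerN;
  apply: module_span_gen; [left|right].
  by congr pair; rewrite /= opprK.
by exists y, x; congr pair; rewrite /= opprK.
Qed.

Lemma trans_fun_subproof v (z : kkt) : trans_fun v (val z) \in kkt_set.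
Proof.
have := set_valP z; case: (val z) => [[u [A B]] y].
rewrite inE /kkt_set /= /kkt_zero => hz.
have -> : (A - D v y, B + D y v) = (A, B) + (-1) *: (D v y, - D y v).
  by rewrite scaleN1r; congr pair; rewrite /= opprK.
by apply: module_spanD => //; apply: module_span_gen; right; exists v, y.
Qed.

Definition theta (z : kkt) : kkt := SigSub (swap_fun_subproof z).
Definition trans v (z : kkt) : kkt := SigSub (trans_fun_subproof v z).
Definition ttrans v : kkt -> kkt := theta \o trans v \o theta.

Lemma quad_fun_subproof y Qinv (z : kkt) :
  cancel (jquad y) Qinv -> cancel Qinv (jquad y) ->
  quad_fun y Qinv (val z) \in kkt_set.
Proof.
move=> QK KQ; have [_ QQ _] := jordan_identitiesP.
have lQ : linear Qinv by move=> k a b; apply: (can_inj QK); rewrite linearP !KQ.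
have DQ a c w : jquad y (D a (jquad y c) w) = D (jquad y a) c (jquad y w).
  by rewrite /jpolar -linearD !QQ !linearB.
have := set_valP z; case: (val z) => [[u [A B]] v].
rewrite inE /kkt_set /= /kkt_zero.
apply: (module_span_image
  (f := fun T => (jquad y \o T.1 \o Qinv, Qinv \o T.2 \o jquad y))).
  move=> k [a b] [c d]; congr pair; apply/funext => w /=.
    by rewrite -[LHS]/(jquad y (k *: a (Qinv w) + c (Qinv w))) linearP.
  by rewrite -[LHS]/(Qinv (k *: b (jquad y w) + d (jquad y w))) lQ.
move=> k _ [->|[a [b ->]]]; apply: module_span_gen; [left|right].
  congr pair; apply/funext => w; rewrite !fctE /= ?KQ//.
  by apply: (can_inj QK); rewrite KQ linearN.
exists (jquad y a), (Qinv b); congr pair; apply/funext => w; rewrite !fctE /=.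
  by rewrite -{1}(KQ b) DQ KQ.
apply: (can_inj QK); rewrite KQ linearN; congr (- _).
by rewrite DQ KQ.
Qed.

(* The actions on `kkt` of the pairs (Q_y, Q_y^-1), for `y` invertible. *)
Definition inner_structure : set (kkt -> kkt) :=
  [set f | exists y Qinv, [/\ cancel (jquad y) Qinv, cancel Qinv (jquad y) &
                              forall z, val (f z) = quad_fun y Qinv (val z)]].

Definition geometry_group : set (kkt -> kkt) :=
  generated (range trans `|` range ttrans).

Definition geometry_parabolic : set (kkt -> kkt) :=
  generated (range ttrans `|` inner_structure).

Definition left_coset (g : kkt -> kkt) : set (kkt -> kkt) :=
  [set g \o p | p in geometry_parabolic].

Definition jordan_geometry : Type := left_coset @` geometry_group.

Lemma geometry_act_subproof (g : geometry_group) (x : jordan_geometry) :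
  [set val g \o f | f in val x] \in left_coset @` geometry_group.
Proof.
have [h hh <-] := set_valP x; rewrite inE; exists (val g \o h).
  by apply: gen_comp => //; exact: set_valP.
by rewrite -[LHS]/((fun p => val g \o (h \o p)) @` _) image_comp.
Qed.

Definition geometry_act (g : geometry_group) (x : jordan_geometry) :
  jordan_geometry := SigSub (geometry_act_subproof g x).

Lemma left_coset_subproof (g : geometry_group) :
  left_coset (val g) \in left_coset @` geometry_group.
Proof. by rewrite inE; exists (val g) => //; exact: set_valP. Qed.

Definition group_point (g : geometry_group) : jordan_geometry :=
  SigSub (left_coset_subproof g).

Lemma geometry_id_subproof : idfun \in geometry_group.
Proof. by rewrite inE; exact: gen_id. Qed.

Lemma geometry_trans_subproof v : trans v \in geometry_group.
Proof. by rewrite inE; apply: gen_mem; left; exists v. Qed.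

(* With the convention [v^+, y^-] = - (D v y, - D y v), the map ttrans y extends
   x |-> (x^-1 - y)^-1, so the inversion x |-> - x^-1 is t_e tt_e t_e, and not
   t_e tt_(-e) t_e; see weyl_plus. *)
Definition weyl : kkt -> kkt := trans jone \o ttrans jone \o trans jone.

Lemma geometry_weyl_subproof : weyl \in geometry_group.
Proof.
rewrite inE; apply: gen_comp; first apply: gen_comp; apply: gen_mem.
- by left; exists jone.
- by right; exists jone.
- by left; exists jone.
Qed.

Definition origin : jordan_geometry :=
  group_point (SigSub geometry_id_subproof).

Definition infinity : jordan_geometry :=
  group_point (SigSub geometry_weyl_subproof).

Definition affine_point (v : V) : jordan_geometry :=
  geometry_act (SigSub (geometry_trans_subproof v)) origin.

Definition transversal_pair (a b : jordan_geometry) : Prop :=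
  exists g : geometry_group,
    a = geometry_act g origin /\ b = geometry_act g infinity.

Lemma weyl_plus (u : V) (z : kkt) :
  val z = (u, (0, 0), 0) -> val (weyl z) = (0, (0, 0), u).
Proof.
have [Q1 _ QD] := jordan_identitiesP.
have De x y : D x jone y = D jone x y by have := QD jone x y; rewrite !Q1.
have Q0 x : jquad (0 : V) x = 0.
  by have := (jquad_quadratic x).1 0 0; rewrite expr0n !scale0r.
have D0 x : D x 0 = 0.
  by apply/funext => y; rewrite /jpolar !linear0 !addr0.
have D0l x : D 0 x = 0.
  by apply/funext => y; rewrite /jpolar add0r Q0 subr0 subrr.
move=> zE; rewrite /weyl /= zE /= !D0 !D0l !subr0 !addr0 !linear0 !add0r.
rewrite !Q1.
have De' : D u jone = D jone u by apply/funext => x; exact: De.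
rewrite !addr0 De' subrr addNr; congr (_, _, _).
have -> : D jone u jone = u + u.
  rewrite /jpolar -mulr2n -scaler_nat (jquad_quadratic u).1 !Q1.
  rewrite -natrX scaler_nat -[(2 ^ 2)%N]/4%N.
  by rewrite !mulrS mulr0n addr0 !addrA !addrK.
by rewrite opprD addrA subrr sub0r addNr.
Qed.

End JordanGeometry.

Arguments geometry_group {K} V.
Arguments origin {K} V.
Arguments infinity {K} V.
Arguments affine_point {K V} v.

Section CyclicOrder.

Variables (K : poRingType) (V : poJordanType K).

Local Notation X := (jordan_geometry V).

Definition cyclic_order (a x b : X) : Prop :=
  exists g : geometry_group V,
    [/\ geometry_act g a = origin V, geometry_act g b = infinity V &
        (affine_point @` symmetric_cone V) (geometry_act g x)].

Definition cyclic_interval (a b : X) : set X := [set x | cyclic_order a x b].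

(* The intersection of a cyclic interval with V, seen as a subset of V. *)
Definition affine_image (a b : X) : set V :=
  affine_point @^-1` cyclic_interval a b.

End CyclicOrder.

(* Main.v *)
Require Import Defs.
From HB Require Import structures.
From mathcomp Require Import all_boot all_order all_algebra.
From mathcomp Require Import boolp classical_sets functions.
From Stdlib Require Import Ring.

Set Implicit Arguments.
Unset Strict Implicit.
Unset Printing Implicit Defensive.

Import Order.TTheory GRing.Theory Num.Theory.
Local Open Scope classical_set_scope.
Local Open Scope ring_scope.

(* By invariance everything follows from ]0, oo[ = Omega and from the fact that
   R is cyclic and transitive.  Elements of P map the Euler element
   E = (id, -id) into E + V^-, so an element of G_0 fixing 0 and oo lies in the
   inner structure group, which preserves Omega; hence ]0, oo[ = Omega.  The
   element w is the swap theta, and maps an invertible y to - y^-1: both facts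
   rest on the identity A Q_y - Q_y B = Q_(Ay, y) for (A, B) in L_0, which is
   read off from the Jordan identities over K[t]/(t^3) at the elements e + t x.
   For x > 0, t_(x^-1) theta maps (x, oo, 0) to (0, x^-1, oo), so R is cyclic;
   transitivity is then transitivity of <, seen from a point moved to oo.
   For u < x < v the triples (u, x, oo) and (x, v, oo) give (u, x, v), and
   conversely; (3) is similar.  In Q x Q with its strict componentwise order the
   interval from (1, 1) to (-1, -1) contains (2, -2), oo, (2, 2) and (-2, -2),
   but not the midpoint 0 of the last two. *)

(* Identities in a module V are identities in the commutative ring K + V with
   V^2 = 0, where the `ring` tactic applies. *)
Section SquareZero.

Variables (K : comPzRingType) (V : lmodType K).

Record square_zero := SquareZero { sqz_fst : K; sqz_snd : V }.

Definition sqz_add x y :=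
  SquareZero (sqz_fst x + sqz_fst y) (sqz_snd x + sqz_snd y).
Definition sqz_opp x := SquareZero (- sqz_fst x) (- sqz_snd x).
Definition sqz_sub x y := sqz_add x (sqz_opp y).
Definition sqz_mul x y := SquareZero (sqz_fst x * sqz_fst y)
  (sqz_fst x *: sqz_snd y + sqz_fst y *: sqz_snd x).
Definition sqz_zero := SquareZero 0 0.
Definition sqz_one := SquareZero 1 0.

Lemma sqz_ring_theory :
  ring_theory sqz_zero sqz_one sqz_add sqz_mul sqz_sub sqz_opp eq.
Proof.
split=> [[a u]|[a u] [b v]|[a u] [b v] [c w]|[a u]|[a u] [b v]|[a u] [b v] [c w]
  |[a u] [b v] [c w]|//|[a u]]; congr SquareZero; rewrite /=.
- exact: add0r.
- exact: add0r.
- exact: addrC.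
- exact: addrC.
- exact: addrA.
- exact: addrA.
- exact: mul1r.
- by rewrite scale1r scaler0 addr0.
- exact: mulrC.
- exact: addrC.
- exact: mulrA.
- by rewrite !scalerDr !scalerA !addrA (mulrC c a) (mulrC c b).
- exact: mulrDl.
- by rewrite scalerDl scalerDr addrACA.
- exact: subrr.
- exact: subrr.
Qed.

Definition sqz v := SquareZero 0 v.
Definition sqz_scalar k := SquareZero k 0.

Lemma sqz_inj u v : sqz u = sqz v -> u = v. Proof. by move=> []. Qed.

Lemma sqz_scalar_inj k l : sqz_scalar k = sqz_scalar l -> k = l.
Proof. by move=> []. Qed.

Lemma sqzD u v : sqz (u + v) = sqz_add (sqz u) (sqz v).
Proof. by congr SquareZero; rewrite /= addr0. Qed.

Lemma sqzN u : sqz (- u) = sqz_opp (sqz u).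
Proof. by congr SquareZero; rewrite /= oppr0. Qed.

Lemma sqz0 : sqz 0 = sqz_zero. Proof. by []. Qed.

Lemma sqzZ k u : sqz (k *: u) = sqz_mul (sqz_scalar k) (sqz u).
Proof. by congr SquareZero; rewrite /= ?mulr0// scale0r addr0. Qed.

Lemma sqz_scalarD k l :
  sqz_scalar (k + l) = sqz_add (sqz_scalar k) (sqz_scalar l).
Proof. by congr SquareZero; rewrite /= addr0. Qed.

Lemma sqz_scalarN k : sqz_scalar (- k) = sqz_opp (sqz_scalar k).
Proof. by congr SquareZero; rewrite /= oppr0. Qed.

Lemma sqz_scalarM k l :
  sqz_scalar (k * l) = sqz_mul (sqz_scalar k) (sqz_scalar l).
Proof. by congr SquareZero; rewrite /= !scaler0 addr0. Qed.

Lemma sqz_scalar0 : sqz_scalar 0 = sqz_zero. Proof. by []. Qed.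

Lemma sqz_scalar1 : sqz_scalar 1 = sqz_one. Proof. by []. Qed.

Definition sqzE := (sqzD, sqzN, sqz0, sqzZ, sqz_scalarD, sqz_scalarN,
  sqz_scalarM, sqz_scalar0, sqz_scalar1).

End SquareZero.

Ltac module_ring V :=
  first [apply: (@sqz_scalar_inj _ V) | apply: (@sqz_inj _ V)];
  rewrite /= ?sqzE;
  first [ring |
    (* `ring` compares atoms syntactically, `move:` up to conversion. *)
    repeat match goal with
    | |- context [@sqz ?K ?W ?x] => move: (@sqz K W x) => ?
    | |- context [@sqz_scalar ?K ?W ?x] => move: (@sqz_scalar K W x) => ?
    end; ring].

(* c0 + c1 t + c2 t^2 in K[t]/(t^3), or in its tensor product with a module. *)
Record trunc3 (M : Type) := Trunc3 { tcoef0 : M; tcoef1 : M; tcoef2 : M }.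

HB.instance Definition _ (M : Type) := gen_eqMixin (trunc3 M).
HB.instance Definition _ (M : Type) := gen_choiceMixin (trunc3 M).

(** * Truncated polynomials as a scalar extension *)

Section Trunc3Zmodule.

Variable M : zmodType.

Definition trunc3_add (a b : trunc3 M) :=
  Trunc3 (tcoef0 a + tcoef0 b) (tcoef1 a + tcoef1 b) (tcoef2 a + tcoef2 b).
Definition trunc3_opp (a : trunc3 M) :=
  Trunc3 (- tcoef0 a) (- tcoef1 a) (- tcoef2 a).

Lemma trunc3_addA : associative trunc3_add.
Proof. by move=> a b c; congr Trunc3; exact: addrA. Qed.

Lemma trunc3_addC : commutative trunc3_add.
Proof. by move=> a b; congr Trunc3; exact: addrC. Qed.

Lemma trunc3_add0 : left_id (Trunc3 0 0 0) trunc3_add.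
Proof. by move=> [a0 a1 a2]; congr Trunc3; exact: add0r. Qed.

Lemma trunc3_addN : left_inverse (Trunc3 0 0 0) trunc3_opp trunc3_add.
Proof. by move=> a; congr Trunc3; exact: addNr. Qed.

HB.instance Definition _ := GRing.isZmodule.Build (trunc3 M)
  trunc3_addA trunc3_addC trunc3_add0 trunc3_addN.

End Trunc3Zmodule.

Section Trunc3Ring.

Variable K : comPzRingType.

Let square_zero_theory := sqz_ring_theory K^o.
Add Ring square_zero_ring : square_zero_theory.

Definition trunc3_mul (a b : trunc3 K) := Trunc3 (tcoef0 a * tcoef0 b)
  (tcoef0 a * tcoef1 b + tcoef1 a * tcoef0 b)
  (tcoef0 a * tcoef2 b + tcoef1 a * tcoef1 b + tcoef2 a * tcoef0 b).

Lemma trunc3_mulA : associative trunc3_mul.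
Proof. by move=> a b c; congr Trunc3; module_ring K^o. Qed.

Lemma trunc3_mulC : commutative trunc3_mul.
Proof. by move=> a b; congr Trunc3; module_ring K^o. Qed.

Lemma trunc3_mul1 : left_id (Trunc3 1 0 0) trunc3_mul.
Proof. by move=> [a0 a1 a2]; congr Trunc3; module_ring K^o. Qed.

Lemma trunc3_mulDl : left_distributive trunc3_mul +%R.
Proof. by move=> a b c; congr Trunc3; module_ring K^o. Qed.

HB.instance Definition _ := GRing.Zmodule_isComPzRing.Build (trunc3 K)
  trunc3_mulA trunc3_mulC trunc3_mul1 trunc3_mulDl.

Definition trunc3C (k : K) := Trunc3 k 0 0.

Lemma trunc3C_zmod_morphism : zmod_morphism trunc3C.
Proof. by move=> a b; congr Trunc3; module_ring K^o. Qed.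

Lemma trunc3C_monoid_morphism : monoid_morphism trunc3C.
Proof. by split=> // a b; congr Trunc3; module_ring K^o. Qed.

HB.instance Definition _ :=
  GRing.isZmodMorphism.Build K (trunc3 K) trunc3C trunc3C_zmod_morphism.
HB.instance Definition _ :=
  GRing.isMonoidMorphism.Build K (trunc3 K) trunc3C trunc3C_monoid_morphism.

End Trunc3Ring.

Section Trunc3Module.

Variables (K : comPzRingType) (V : lmodType K).

Let square_zero_theory := sqz_ring_theory V.
Add Ring square_zero_ring : square_zero_theory.

Definition trunc3_scale (k : trunc3 K) (v : trunc3 V) :=
  Trunc3 (tcoef0 k *: tcoef0 v)
    (tcoef0 k *: tcoef1 v + tcoef1 k *: tcoef0 v)
    (tcoef0 k *: tcoef2 v + tcoef1 k *: tcoef1 v + tcoef2 k *: tcoef0 v).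

Lemma trunc3_scaleA a b v :
  trunc3_scale a (trunc3_scale b v) = trunc3_scale (a * b) v.
Proof. by congr Trunc3; module_ring V. Qed.

Lemma trunc3_scale1 : left_id 1 trunc3_scale.
Proof. by move=> [v0 v1 v2]; congr Trunc3; module_ring V. Qed.

Lemma trunc3_scaleDr : right_distributive trunc3_scale +%R.
Proof. by move=> a b v; congr Trunc3; module_ring V. Qed.

Lemma trunc3_scaleDl v : {morph trunc3_scale^~ v : a b / a + b}.
Proof. by move=> a b; congr Trunc3; module_ring V. Qed.

HB.instance Definition _ := GRing.Zmodule_isLmodule.Build (trunc3 K) (trunc3 V)
  trunc3_scaleA trunc3_scale1 trunc3_scaleDr trunc3_scaleDl.

Definition trunc3V (v : V) := Trunc3 v 0 0.

Lemma trunc3V_linear : linear_for (@trunc3C K \; *:%R) trunc3V.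
Proof. by move=> k a b; congr Trunc3; module_ring V. Qed.

HB.instance Definition _ := GRing.isLinear.Build K V (trunc3 V)
  (@trunc3C K \; *:%R) trunc3V trunc3V_linear.

Let t : trunc3 K := Trunc3 0 1 0.

Let trunc3_basisV (v : trunc3 V) :
  v = trunc3V (tcoef0 v) + t *: trunc3V (tcoef1 v) +
      t ^+ 2 *: trunc3V (tcoef2 v).
Proof. by case: v => v0 v1 v2; congr Trunc3; module_ring V. Qed.

Let trunc3_basisC (k : trunc3 K) :
  k = trunc3C (tcoef0 k) + t * trunc3C (tcoef1 k) +
      t ^+ 2 * trunc3C (tcoef2 k).
Proof. by case: k => v0 v1 v2; congr Trunc3; module_ring V. Qed.

Let trunc3_t3 : t ^+ 3 = 0.
Proof. by congr Trunc3; module_ring V. Qed.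

Section Extension.

Variables (U : lmodType (trunc3 K)) (f : {linear V -> U | @trunc3C K \; *:%R}).

Let square_zero_theoryU := sqz_ring_theory U.
Add Ring square_zero_ringU : square_zero_theoryU.

(** Since 1, t and t^2 span, a linear extension of [f] can only have this form. Expanding k times
    the image of u also produces terms in t^3 and t^4; they vanish by the relation [ttt], which is
    handed to [ring]. *)
Lemma trunc3V_factor_linear : linear (fun v : trunc3 V =>
  f (tcoef0 v) + t *: f (tcoef1 v) + t ^+ 2 *: f (tcoef2 v)).
Proof.
move=> k u v; rewrite /= !linearD /= !linearZ /=.
move: (trunc3_basisC k); move: (tcoef0 k) (tcoef1 k) (tcoef2 k) => k0 k1 k2 ->.
have : sqz_mul (sqz_scalar U t) (sqz_mul (sqz_scalar U t) (sqz_scalar U t)) =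
    sqz_zero U.
  by rewrite -!sqz_scalarM (trunc3_t3 : t * (t * t) = 0).
move=> ttt; apply: sqz_inj; rewrite ?expr2 ?sqzE; ring [ttt].
Qed.

End Extension.

(** This makes the Jordan identities available over K[t]/(t^3), and their coefficients are the
    linearized identities over K. *)
Lemma trunc3V_extension : scalar_extension (phi := @trunc3C K) trunc3V.
Proof.
move=> U f; split=> [|g h gh v]; last first.
  by rewrite (trunc3_basisV v) !linearD !linearZ/= !gh.
pose g (v : trunc3 V) :=
  f (tcoef0 v) + t *: f (tcoef1 v) + t ^+ 2 *: f (tcoef2 v).
pose m := GRing.isLinear.Build (trunc3 K) (trunc3 V) U *:%R
  g (trunc3V_factor_linear f).
exists (HB.pack g m : {linear trunc3 V -> U}) => v; rewrite /= /g /=.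
by rewrite !linear0 !addr0.
Qed.

End Trunc3Module.

(** * Jordan identities *)

Section QuadraticMaps.

Variables (K : comPzRingType) (V : lmodType K) (Q : V -> {linear V -> V}).
Hypothesis quadQ : forall x, quadratic_map (fun a => Q a x).

Local Notation D := (jpolar Q).

Let square_zero_theory := sqz_ring_theory V.
Add Ring square_zero_ring : square_zero_theory.

Lemma jpolarE a b x : Q (a + b) x = Q a x + Q b x + D a x b.
Proof. by rewrite /jpolar; module_ring V. Qed.

Lemma jquadZ k a x : Q (k *: a) x = k ^+ 2 *: Q a x.
Proof. exact: (quadQ x).1. Qed.

Lemma jpolarC a x b : D a x b = D b x a.
Proof. by rewrite /jpolar (addrC b a) addrAC. Qed.

Lemma jpolarPl k a b x c : D (k *: a + b) x c = k *: D a x c + D b x c.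
Proof. exact: ((quadQ x).2 c). Qed.

Lemma jpolarDl a b x c : D (a + b) x c = D a x c + D b x c.
Proof. by rewrite -[a]scale1r jpolarPl !scale1r. Qed.

Lemma jpolar0l x c : D 0 x c = 0.
Proof. by apply: (@addrI _ (D 0 x c)); rewrite -jpolarDl !addr0. Qed.

Lemma jpolarZl k a x c : D (k *: a) x c = k *: D a x c.
Proof. by rewrite -[k *: a]addr0 jpolarPl jpolar0l addr0. Qed.

Lemma jpolarNl a x c : D (- a) x c = - D a x c.
Proof. by rewrite -scaleN1r jpolarZl scaleN1r. Qed.

Lemma jpolarDm a x y c : D a (x + y) c = D a x c + D a y c.
Proof. by rewrite /jpolar !linearD; module_ring V. Qed.

Lemma jpolarZm k a x c : D a (k *: x) c = k *: D a x c.
Proof. by rewrite /jpolar !linearZ; module_ring V. Qed.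

Lemma jpolar0m a c : D a 0 c = 0.
Proof. by rewrite /jpolar !linear0 !addr0. Qed.

Lemma jpolarNm a x c : D a (- x) c = - D a x c.
Proof. by rewrite -scaleN1r jpolarZm scaleN1r. Qed.

Lemma jpolarDr a x b c : D a x (b + c) = D a x b + D a x c.
Proof. by rewrite jpolarC jpolarDl !(jpolarC _ x a). Qed.

Lemma jpolarZr k a x c : D a x (k *: c) = k *: D a x c.
Proof. by rewrite jpolarC jpolarZl jpolarC. Qed.

Lemma jpolar0r a x : D a x 0 = 0. Proof. by rewrite jpolarC jpolar0l. Qed.

Lemma jpolar_linear a x : linear (D a x).
Proof. by move=> k b c; rewrite jpolarDr jpolarZr. Qed.

Lemma jquad0 x : Q 0 x = 0.
Proof. by rewrite -[X in Q X](scale0r 0) jquadZ expr2 mul0r scale0r. Qed.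

Lemma jquadN a x : Q (- a) x = Q a x.
Proof. by rewrite -scaleN1r jquadZ sqrrN expr1n scale1r. Qed.

Lemma jpolar_diag a x : D a x a = Q a x + Q a x.
Proof.
rewrite /jpolar -[in X in Q X _](scale1r a) -scalerDl jquadZ.
by rewrite expr2; module_ring V.
Qed.

(** The coefficients of Q_a x, where Q_a has the polarized expansion Q_(a0) + t D(a0, -, a1) + t^2
    (Q_(a1) + D(a0, -, a2)). *)
Definition trunc3_quad_fun (a x : trunc3 V) := Trunc3
  (Q (tcoef0 a) (tcoef0 x))
  (Q (tcoef0 a) (tcoef1 x) + D (tcoef0 a) (tcoef0 x) (tcoef1 a))
  (Q (tcoef0 a) (tcoef2 x) + D (tcoef0 a) (tcoef1 x) (tcoef1 a) +
   Q (tcoef1 a) (tcoef0 x) + D (tcoef0 a) (tcoef0 x) (tcoef2 a)).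

Lemma trunc3_quad_linear a : linear (trunc3_quad_fun a).
Proof.
move=> k x y; congr Trunc3; rewrite /= ?(linearD, linearZ) /=
  ?(jpolarDm, jpolarZm); module_ring V.
Qed.

HB.instance Definition _ a := GRing.isLinear.Build (trunc3 K)
  (trunc3 V) (trunc3 V) *:%R (trunc3_quad_fun a) (trunc3_quad_linear a).

Definition trunc3_quad (a : trunc3 V) : {linear trunc3 V -> trunc3 V} :=
  trunc3_quad_fun a.

Lemma trunc3_jpolar a x b : jpolar trunc3_quad a x b = Trunc3
  (D (tcoef0 a) (tcoef0 x) (tcoef0 b))
  (D (tcoef0 a) (tcoef1 x) (tcoef0 b) + D (tcoef0 a) (tcoef0 x) (tcoef1 b) +
   D (tcoef1 a) (tcoef0 x) (tcoef0 b))
  (D (tcoef0 a) (tcoef2 x) (tcoef0 b) + D (tcoef0 a) (tcoef1 x) (tcoef1 b) +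
   D (tcoef1 a) (tcoef1 x) (tcoef0 b) + D (tcoef1 a) (tcoef0 x) (tcoef1 b) +
   D (tcoef0 a) (tcoef0 x) (tcoef2 b) + D (tcoef2 a) (tcoef0 x) (tcoef0 b)).
Proof.
congr Trunc3; rewrite /= ?(jpolarE, jpolarDr, jpolarDl).
- by rewrite (jpolarC (tcoef1 a)); module_ring V.
- rewrite !(jpolarC (tcoef1 a) _ (tcoef0 b)) !(jpolarC (tcoef2 a)).
  by module_ring V.
Qed.

Lemma trunc3_quad_quadratic x : quadratic_map (fun a => trunc3_quad a x).
Proof.
split=> [k a|b k a c]; rewrite ?expr2; last first.
  rewrite -!/(jpolar _ _ _ _) !trunc3_jpolar; congr Trunc3;
  by rewrite /= ?(jpolarDl, jpolarZl); module_ring V.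
congr Trunc3; rewrite /=.
- by rewrite jquadZ expr2; module_ring V.
- rewrite !(jquadZ, jpolarDr, jpolarZl, jpolarZr) jpolar_diag expr2.
  module_ring V.
- rewrite !(jpolarE, jquadZ, jpolarDr, jpolarZl, jpolarZr) !jpolar_diag !expr2.
  by rewrite (jpolarC (tcoef1 a) _ (tcoef0 a)); module_ring V.
Qed.

End QuadraticMaps.

(* The triple product is abstract here because `jpolar` unfolds to a sum, which
   the additivity rules below would match. *)
Section TripleIdentities.

Variables (K : comPzRingType) (V : lmodType K) (e : V).
Variables (Q : V -> V -> V) (D : V -> V -> V -> V).
(** The circle product: xy + yx in a special Jordan algebra, and twice the linear Jordan product
    when 2 is invertible. *)
Local Notation "x ** y" := (D x e y) (at level 40, left associativity).

Hypothesis QDl : forall a b x, Q (a + b) x = Q a x + Q b x + D a x b.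
Hypothesis QDr : forall a x y, Q a (x + y) = Q a x + Q a y.
Hypothesis DC : forall a x b, D a x b = D b x a.
Hypothesis DDl : forall a b x c, D (a + b) x c = D a x c + D b x c.
Hypothesis Q_one : forall x, Q e x = x.
Hypothesis D_onel : forall x y, D e x y = x ** y.
Hypothesis D_diag : forall a x, D a x a = Q a x + Q a x.
Hypothesis Q_t : forall x b z, D b z (x ** b) = Q b (x ** z) + x ** Q b z.
Hypothesis Q_t2 : forall x b z, D b z (Q x b) + Q (x ** b) z =
  Q x (Q b z) + Q b (Q x z) + x ** Q b (x ** z).
Hypothesis D_t : forall x b w,
  D x b w + b ** (x ** w) = D b x w + x ** (b ** w).

Let square_zero_theory := sqz_ring_theory V.
Add Ring square_zero_ring : square_zero_theory.

Let DDr a x b c : D a x (b + c) = D a x b + D a x c.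
Proof. by rewrite DC DDl !(DC _ x a). Qed.

Let DBr a x b c : D a x (b - c) = D a x b - D a x c.
Proof. by apply: (@addIr _ (D a x c)); rewrite -DDr !subrK. Qed.

Let QB a x y : Q a (x - y) = Q a x - Q a y.
Proof. by apply: (@addIr _ (Q a y)); rewrite -QDr !subrK. Qed.

(** Polarization of [Q_t] in [b]: its instances at b and at c are subtracted from the one at b + c.
    The next lemma polarizes [Q_t2] in [x] in the same way. *)
Lemma triple_t x b c z :
  D b z (x ** c) + D c z (x ** b) = D b (x ** z) c + x ** D b z c.
Proof.
have := Q_t x (b + c) z.
rewrite !(DDr, DDl, QDl) !Q_t => H.
apply: (@addIr _ (Q b (x ** z) + Q c (x ** z) + x ** Q b z + x ** Q c z)).
apply: etrans (etrans H _); module_ring V.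
Qed.

Lemma triple_t2 x y b z :
  D b z (D x b y) + D (x ** b) z (y ** b) =
  D x (Q b z) y + Q b (D x z y) + x ** Q b (y ** z) + y ** Q b (x ** z).
Proof.
have h := Q_t2 (x + y) b z; have hx := Q_t2 x b z; have hy := Q_t2 y b z.
move: h; rewrite !(DDl, DDr, QDl, QDr) => h.
apply: (@addIr _ ((D b z (Q x b) + Q (x ** b) z) +
  (D b z (Q y b) + Q (y ** b) z))).
rewrite {2}hx {2}hy.
apply: etrans (etrans h _); module_ring V.
Qed.

(** This is [triple_t] with one argument equal to e, where z ** e = z + z. *)
Lemma triple_mul_mul x y z : D x y z + D x y z + y ** (z ** x) =
  x ** (z ** y) + z ** (x ** y).
Proof.
have := triple_t z x e y.
rewrite -(D_onel z e) D_diag !Q_one DDr (DC x _ e) (DC x y e) !D_onel.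
by rewrite (DC (D z e y) e x) (DC y e x).
Qed.

(** Adding [D_t] to [triple_mul_mul] cancels one of the two copies of D y z x, so no division by 2
    occurs. *)
Lemma tripleD_mul x y z : D x y z + D x z y = x ** (y ** z).
Proof.
have h1 := D_t z y x; have h2 := triple_mul_mul y z x.
apply: (@addIr _ (y ** (z ** x) + D y z x + z ** (x ** y))).
transitivity ((D z y x + y ** (z ** x)) + (D y z x + D y z x + z ** (x ** y))).
  by rewrite (DC x y) (DC x z); module_ring V.
rewrite h1 h2 (DC x e z) (DC x e y); module_ring V.
Qed.

(* By tripleD_mul, D a c z = a ** (c ** z) - D a z c; the operators of the form
   `x ** _` and Q y then commute up to triple_t and triple_t2. *)
Lemma triple_quad a c y z :
  D a c (Q y z) + Q y (D c a z) = D (D a c y) z y.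
Proof.
have E x v w : D x v w = x ** (v ** w) - D x w v.
  by rewrite -tripleD_mul addrK.
have T w v : w ** Q y v = D y v (w ** y) - Q y (w ** v).
  by apply: (@addIr _ (Q y (w ** v))); rewrite subrK Q_t; exact: addrC.
rewrite (E a c (Q y z)) (E c a z) T (DC (D a c y)) (E a c y) !(QB, DBr).
have -> : a ** D y z (c ** y) = D y z (a ** (c ** y)) +
    D (c ** y) z (a ** y) - D y (a ** z) (c ** y).
  by rewrite triple_t; module_ring V.
have -> : Q y (c ** (a ** z)) = D y (a ** z) (c ** y) - c ** Q y (a ** z).
  by rewrite Q_t; module_ring V.
have -> : D y z (D a y c) = D a (Q y z) c + Q y (D a z c) +
    a ** Q y (c ** z) + c ** Q y (a ** z) - D (a ** y) z (c ** y).
  by rewrite -triple_t2; module_ring V.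
rewrite (DC c z a) (DC (c ** y)); module_ring V.
Qed.

End TripleIdentities.

Section JordanIdentities.

Variables (K : comPzRingType) (V : jordanAlgType K).

Local Notation Q := (@jquad K V).
Local Notation D := (jpolar Q).
Local Notation e := (jone : V).
Local Notation "x ** y" := (D x e y) (at level 40, left associativity).

Let square_zero_theory := sqz_ring_theory V.
Add Ring square_zero_ring : square_zero_theory.

Let quadQ : forall x, quadratic_map (fun a => Q a x) := @jquad_quadratic K V.

Let DC := jpolarC Q.

Lemma jquad_one x : Q e x = x.
Proof. by have [] := jordan_identitiesP V. Qed.

Lemma jquad_fundamental a b x : Q (Q a b) x = Q a (Q b (Q a x)).
Proof. by have [] := jordan_identitiesP V. Qed.

Lemma jquad_jpolarC a x y : Q a (D x a y) = D a x (Q a y).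
Proof. by have [] := jordan_identitiesP V. Qed.

Lemma jpolar_fundamental a b x c : D (Q a b) x (Q a c) = Q a (D b (Q a x) c).
Proof. by rewrite /jpolar -linearD !jquad_fundamental !linearB. Qed.

Lemma jpolar_onem x y : D x e y = D e x y.
Proof. by have := jquad_jpolarC e x y; rewrite !jquad_one. Qed.

Lemma jpolar_oner x y : D x y e = D x e y.
Proof. by rewrite DC -jpolar_onem DC. Qed.

Lemma trunc3_jordan : jordan_identities (trunc3V e) (trunc3_quad Q).
Proof.
apply: (@jordan_scalar_extension K V (trunc3 K) (@trunc3C K) (trunc3 V)
  (@trunc3V K V) (trunc3_quad Q) (@trunc3V_extension K V)).
  exact: trunc3_quad_quadratic.
move=> a x; congr Trunc3.
  by rewrite /= linear0 (jpolar0r quadQ) addr0.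
by rewrite /= linear0 !(jpolar0r quadQ) (jquad0 quadQ) !addr0.
Qed.

Let jquadr0 a : Q a 0 = 0. Proof. exact: linear0. Qed.
Let jz := (jquadr0, jpolar0l quadQ, jpolar0m Q, jpolar0r quadQ,
  jquad0 quadQ, jquad_one, add0r, addr0, subr0).

(* Coefficients of t and t^2 in Q_(Q_a b) = Q_a Q_b Q_a at a = e + t x. *)
Lemma jquad_fundamental_t x b z :
  D b z (x ** b) = Q b (x ** z) + x ** Q b z.
Proof.
have [_ /(_ (Trunc3 e x 0) (trunc3V b) (trunc3V z)) H _] := trunc3_jordan.
have := congr1 (@tcoef1 V) H; rewrite /= !jz.
by rewrite -!jpolar_onem !(DC _ _ x) => ->.
Qed.

Lemma jquad_fundamental_t2 x b z : D b z (Q x b) + Q (x ** b) z =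
  Q x (Q b z) + Q b (Q x z) + x ** Q b (x ** z).
Proof.
have [_ /(_ (Trunc3 e x 0) (trunc3V b) (trunc3V z)) H _] := trunc3_jordan.
have := congr1 (@tcoef2 V) H; rewrite /= !jz.
rewrite -!jpolar_onem !(DC _ _ x) [LHS]addrC => ->.
by module_ring V.
Qed.

(* Coefficient of t in Q_a D_(x,a) = D_(a,x) Q_a at a = e + t b. *)
Lemma jquad_jpolarC_t x b w : D x b w + b ** (x ** w) = D b x w + x ** (b ** w).
Proof.
have [_ _ /(_ (Trunc3 e b 0) (trunc3V x) (trunc3V w)) H] := trunc3_jordan.
have := congr1 (@tcoef1 V) H; rewrite !(trunc3_jpolar quadQ) /= !jz.
by rewrite -!jpolar_onem !(DC _ _ b) => ->; rewrite addrC.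
Qed.

(** An infinitesimal form of the fundamental formula: it is the condition [str_pair] for the
    generators (D a c, - D c a) of L_0. *)
Lemma jpolar_quad a c y z :
  D a c (Q y z) + Q y (D c a z) = D (D a c y) z y.
Proof.
apply: (@triple_quad _ _ e (fun a x => Q a x) D).
- exact: jpolarE.
- by move=> *; exact: linearD.
- exact: jpolarC.
- exact: jpolarDl.
- exact: jquad_one.
- by move=> *; rewrite jpolar_onem.
- exact: jpolar_diag.
- exact: jquad_fundamental_t.
- exact: jquad_fundamental_t2.
- exact: jquad_jpolarC_t.
Qed.

End JordanIdentities.

(** * The group of the Kantor-Koecher-Tits algebra *)

Section KantorKoecherTits.

Variables (K : comPzRingType) (V : jordanAlgType K).

Local Notation Q := (@jquad K V).
Local Notation D := (jpolar Q).
Local Notation e := (jone : V).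
Local Notation theta := (@theta K V).
Local Notation trans := (@trans K V).
Local Notation ttrans := (@ttrans K V).
Local Notation weyl := (@weyl K V).

Let quadQ : forall x, quadratic_map (fun a => Q a x) := @jquad_quadratic K V.

Let square_zero_theory := sqz_ring_theory V.
Add Ring square_zero_ring : square_zero_theory.

(* The Lie algebra of the structure group: the derivative at the identity of
   Q_(g y) = g Q_y h^-1 on pairs (g, h). *)
Definition str_pair (T : (V -> V) * (V -> V)) := [/\ linear T.1, linear T.2 &
  forall y z, T.1 (Q y z) - Q y (T.2 z) = D (T.1 y) z y].

Lemma str_pair_scaleD k T U :
  str_pair T -> str_pair U -> str_pair (k *: T + U).
Proof.
move=> [lT1 lT2 TQ] [lU1 lU2 UQ]; split=> [c x y|c x y|y z].
- rewrite -[LHS]/(k *: T.1 (c *: x + y) + U.1 (c *: x + y)).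
  rewrite -[RHS]/(c *: (k *: T.1 x + U.1 x) + (k *: T.1 y + U.1 y)).
  by rewrite lT1 lU1; module_ring V.
- rewrite -[LHS]/(k *: T.2 (c *: x + y) + U.2 (c *: x + y)).
  rewrite -[RHS]/(c *: (k *: T.2 x + U.2 x) + (k *: T.2 y + U.2 y)).
  by rewrite lT2 lU2; module_ring V.
- rewrite -[LHS]/(k *: T.1 (Q y z) + U.1 (Q y z) - Q y (k *: T.2 z + U.2 z)).
  rewrite -[RHS]/(D (k *: T.1 y + U.1 y) z y).
  by rewrite (jpolarPl quadQ) -TQ -UQ linearP; module_ring V.
Qed.

Lemma str_pair0 : str_pair 0.
Proof.
split=> [c x y|c x y|y z].
  by rewrite -[LHS]/0 -[RHS]/(c *: 0 + 0) scaler0 addr0.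
  by rewrite -[LHS]/0 -[RHS]/(c *: 0 + 0) scaler0 addr0.
rewrite -[LHS]/(0 - Q y 0) -[RHS]/(D 0 z y).
by rewrite (jpolar0l quadQ) linear0 subr0.
Qed.

(** The condition is linear in the pair, so the generators suffice. For (id, -id) it is D u v u = 2
    Q u v; for the others it is [jpolar_quad]. *)
Lemma kkt_zero_str T : kkt_zero T -> str_pair T.
Proof.
move=> [s hs ->]; elim: s hs => [|[k T'] s IH] hs.
  by rewrite big_nil; exact: str_pair0.
rewrite big_cons /=; apply: str_pair_scaleD; last first.
  by apply: IH => p ps; apply: hs; rewrite inE ps orbT.
have [/= ->|/= [x [y ->]]] := hs _ (mem_head _ _).
  split=> [//|c u v|u v].
    by rewrite -[LHS]/(- (c *: u + v)) -[RHS]/(c *: - u - v) opprD scalerN.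
  rewrite -[LHS]/(Q u v - Q u (- v)) -[RHS]/(D u v u).
  by rewrite linearN opprK (jpolar_diag quadQ).
split=> [c u v|c u v|u v].
- exact: jpolar_linear.
- rewrite -[LHS]/(- D y x (c *: u + v)) -[RHS]/(c *: - D y x u - D y x v).
  by rewrite (jpolar_linear quadQ) opprD scalerN.
- rewrite -[LHS]/(D x y (Q u v) - Q u (- D y x v)) linearN opprK.
  exact: jpolar_quad.
Qed.

Section StrPair.

Variable T : (V -> V) * (V -> V).
Hypothesis strT : str_pair T.

(** For T = (A, B), the structure condition at y = z = e reads A e - B e = 2 A e. *)
Lemma str_pair_one : T.2 e = - T.1 e.
Proof.
have [_ _ /(_ e e)] := strT; rewrite !jquad_one => TQ.
have E : D (T.1 e) e e = T.1 e + T.1 e.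
  by rewrite jpolar_onem (jpolar_diag quadQ) !jquad_one.
apply: (@addrI _ (- T.1 e)); apply: oppr_inj.
by rewrite opprD opprK TQ E; module_ring V.
Qed.

(** The structure condition at y = e; it shows that the first map of a pair determines the
    second. *)
Lemma str_pair_snd z : T.2 z = T.1 z - D (T.1 e) e z.
Proof.
have [_ _ /(_ e z)] := strT; rewrite !jquad_one => TQ.
by rewrite -jpolar_oner -TQ; module_ring V.
Qed.

Lemma str_pair_add x y : T.1 (x + y) = T.1 x + T.1 y.
Proof. by have [lT _ _] := strT; have := lT 1 x y; rewrite !scale1r. Qed.

Lemma str_pairN x : T.1 (- x) = - T.1 x.
Proof.
apply: (@addrI _ (T.1 x)); rewrite -str_pair_add !subrr.
by apply: (@addrI _ (T.1 0)); rewrite -str_pair_add !addr0.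
Qed.

End StrPair.

(** That [swap_fun] preserves [kkt_set], applied to (0, T, 0), shows that L_0 is stable under
    exchanging the two maps. *)
Lemma str_pair_swap T : kkt_zero T -> str_pair (T.2, T.1).
Proof.
case: T => A B hT.
have hz : kkt_set ((0, (A, B), 0) : kkt_ambient V) by [].
have := swap_fun_subproof (SigSub (mem_set hz)).
by rewrite inE /= => /kkt_zero_str.
Qed.

(** The middle component is recorded as an element of L_0 because equations such as [weylE] fail for
    arbitrary pairs of maps. *)
Lemma kkt_ext (g h : kkt V -> kkt V) :
  (forall u A B y (z : kkt V), kkt_zero (A, B) -> val z = (u, (A, B), y) ->
    val (g z) = val (h z)) -> g = h.
Proof.
move=> gh; apply/funext => z; apply/val_inj.
have := set_valP z; case E : (val z) => [[u [A B]] y] hz.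
exact: (gh u A B y).
Qed.

Lemma thetaK : theta \o theta = idfun.
Proof. by apply: kkt_ext => u A B y z _ E; rewrite /= E. Qed.

Lemma trans0 : trans 0 = idfun.
Proof.
apply: kkt_ext => u A B y z hz E; rewrite /= E /=.
have D0 x : D 0 x = 0.
  by apply/funext => w; rewrite (jpolar0l quadQ).
have D0r x : D x 0 = 0 by apply/funext => w; rewrite (jpolar0m Q).
have A0 : A 0 = 0.
  have := str_pairN (kkt_zero_str hz) 0; rewrite /= oppr0 => /eqP.
  have := str_pair_add (kkt_zero_str hz) 0 0; rewrite /= addr0.
  by move=> /eqP; rewrite -subr_eq0 opprD addNKr oppr_eq0 => /eqP.
by rewrite D0 D0r A0 (jquad0 quadQ) !subr0 !addr0.
Qed.

Lemma trans_comp v w : trans v \o trans w = trans (v + w).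
Proof.
apply: kkt_ext => u A B y z hz E; rewrite /= E /=.
have AD : forall x y, A (x + y) = A x + A y := str_pair_add (kkt_zero_str hz).
congr (_, (_, _), _).
- rewrite AD jpolarE -[(A - _) v]/(A v - D w y v) (jpolarC Q w).
  by module_ring V.
- by apply/funext => x; rewrite !fctE (jpolarDl quadQ); module_ring V.
- by apply/funext => x; rewrite !fctE (jpolarDm Q); module_ring V.
Qed.

(** After expansion the two sides differ by multiples of B e + A e and of B - A + D (A e) e, which
    vanish on L_0 by [str_pair_one] and [str_pair_snd]. Hence [theta] lies in G_0, and it exchanges
    the origin and infinity. *)
Lemma weylE : weyl = theta.
Proof.
apply: kkt_ext => u A B y z hz E; rewrite /= E /=.
have AE : B e = - A e := str_pair_one (kkt_zero_str hz).
have BE x : B x = A x - D (A e) e x := str_pair_snd (kkt_zero_str hz) x.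
have fE (f g : V -> V) x : (f + g) x = f x + g x by [].
have fN (f : V -> V) x : (- f) x = - f x by [].
have De w : D w e e = w + w.
  by rewrite jpolar_onem (jpolar_diag quadQ) !jquad_one.
have DeC w x : D e w x = D w e x by rewrite jpolar_onem.
rewrite !jquad_one !fE AE fN !DeC !De.
have -> : y - (- A e + (y + y)) + (u - A e + y) = u by module_ring V.
set u1 := u - A e + y.
have Du1 x : D u1 e x = D u e x - D (A e) e x + D y e x.
  by rewrite /u1 !(jpolarDl quadQ) (jpolarNl quadQ).
congr (_, (_, _), _).
- by rewrite /u1; module_ring V.
- by apply/funext => x; rewrite !fE !fN !DeC Du1 BE; module_ring V.
- by apply/funext => x; rewrite !fE !fN !DeC Du1 BE; module_ring V.
Qed.

(** With i = Qinv y, the fundamental formula gives Q_y = Q_(Q_y i) = Q_y Q_i Q_y. *)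
Lemma jquad_inv y Qinv z : cancel (Q y) Qinv -> cancel Qinv (Q y) ->
  Q (Qinv y) z = Qinv z.
Proof.
move=> QK KQ.
by apply: (can_inj QK); rewrite KQ -{1}[z]KQ -jquad_fundamental !KQ.
Qed.

Section Inverse.

Variables (y i : V).
Hypotheses (QK : cancel (Q y) (Q i)) (KQ : cancel (Q i) (Q y)).
Hypothesis Qyi : Q y i = y.

(** Both sides have the image D y z (Q y w) under the injective map [Q y]. *)
Lemma jpolar_invl z w : D i (Q y z) w = D z y w.
Proof.
by apply: (can_inj QK); rewrite -jpolar_fundamental Qyi jquad_jpolarC.
Qed.

Lemma jquad_invK : Q i y = i. Proof. by rewrite -{1}Qyi QK. Qed.

End Inverse.

(** An invertible element with its inverse. As Q_(y^-1) = Q_y^-1, the inverse operator is again of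
    the form [Q i], and the relation is symmetric in y and i. *)
Definition jinverse_pair (y i : V) :=
  [/\ cancel (Q y) (Q i), cancel (Q i) (Q y) & Q y i = y].

Lemma jinverse_pair_sym y i : jinverse_pair y i -> jinverse_pair i y.
Proof. by move=> [QK KQ Qyi]; split=> //; exact: jquad_invK. Qed.

Lemma jinvertible_pair y : jinvertible y -> exists i, jinverse_pair y i.
Proof.
move=> [Qinv QK KQ]; exists (Qinv y).
by split=> [z|z|]; rewrite ?(jquad_inv _ QK KQ) ?QK ?KQ.
Qed.

Lemma jinverse_pair_invertible y i : jinverse_pair y i -> jinvertible y.
Proof. by move=> [QK KQ _]; exists (Q i). Qed.

Lemma jinverse_pairN y i : jinverse_pair y i -> jinverse_pair (- y) (- i).
Proof.
move=> [QK KQ Qyi]; split=> [z|z|]; rewrite !(jquadN quadQ) ?QK ?KQ//.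
by rewrite linearN /= Qyi.
Qed.

Definition levi_map y i (h : jinverse_pair y i) (z : kkt V) : kkt V :=
  let: And3 QK KQ _ := h in SigSub (quad_fun_subproof z QK KQ).

Lemma inner_structure_levi y i (h : jinverse_pair y i) :
  inner_structure (levi_map h).
Proof. by case: h => QK KQ Qyi; exists y, (Q i). Qed.

(* The right-hand side is in P, so theta t_y P = t_(-i) P: theta maps the point
   y to - y^-1. *)
Lemma trans_theta_trans y i (h : jinverse_pair y i) :
  trans i \o theta \o trans y = ttrans (- y) \o levi_map (jinverse_pair_sym h).
Proof.
apply: kkt_ext => u A B v z hz E.
have -> : val ((ttrans (- y) \o levi_map (jinverse_pair_sym h)) z) =
    swap_fun (trans_fun (- y) (swap_fun (quad_fun i (Q y) (val z)))).
  by case: (jinverse_pair_sym h).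
have [QK KQ Qyi] := h; have Qiy := jquad_invK QK Qyi.
have fE (f g : V -> V) x : (f + g) x = f x + g x by [].
have fN (f : V -> V) x : (- f) x = - f x by [].
have [_ _ AQ] := kkt_zero_str hz; rewrite /= in AQ.
have BN x : B (- x) = - B x := str_pairN (str_pair_swap hz) x.
have Dl := jpolar_invl QK Qyi; have Dr := jpolar_invl KQ Qiy.
have Di x : D x y i = x + x by rewrite -Dl (jpolar_diag quadQ) QK.
have Di' x : D x i y = x + x by rewrite -Dr (jpolar_diag quadQ) KQ.
(* The structure condition at z = i, where Q y i = y and D (A y) i y = 2 A y. *)
have QB : Q y (B i) = - A y.
  have := AQ y i; rewrite Qyi Di' => AQi.
  by apply: (@addrI _ (- A y)); rewrite -opprD -AQi; module_ring V.
have Bi : B i = - Q i (A y) by rewrite -linearN -QB QK.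
rewrite /= E /= !(jquadN quadQ) KQ !fE /=.
rewrite (linearN (Q i) y : Q i (- y) = - Q i y) Qiy BN.
rewrite (linearN (Q y) (B i) : Q y (- B i) = - Q y (B i)) QB opprK.
have u1E : Q y v - A y + u = u - A y + Q y v by module_ring V.
rewrite u1E; set u1 := u - A y + Q y v.
have Du1 x : D i u1 x = D i u x - D i (A y) x + D v y x.
  by rewrite /u1 !jpolarDm jpolarNm Dl.
have uD1 x : D u1 i x = D u i x - D (A y) i x + D y v x.
  by rewrite /u1 !(jpolarDl quadQ) (jpolarNl quadQ) -[v in RHS]QK Dr.
congr (_, (_, _), _).
- rewrite Di Bi /u1 (linearD (Q i)) (linearB (Q i)) /= QK; module_ring V.
- apply/funext => x; rewrite !fE !fN /= Du1 jpolarNm -[D (Q i u) y x]Dl KQ.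
  (* The structure condition, read as a formula for the conjugate of A by [Q y]; in the last
     component it gives the conjugate of B. *)
  have -> : Q i (A (Q y x)) = B x + D i (A y) x; last by module_ring V.
  apply: (can_inj QK); rewrite KQ (linearD (Q y)) /=.
  rewrite -[in D i (A y) x](KQ (A y)) Dl.
  by rewrite jpolarC jquad_jpolarC KQ jpolarC -AQ; module_ring V.
- apply/funext => x; rewrite !fE !fN /= uD1 (jpolarNl quadQ) Dr.
  have -> : Q y (B (Q i x)) = A x - D (A y) i x; last by module_ring V.
  have := AQ y (Q i x); rewrite KQ (jpolarC _ (A y)) Dr jpolarC => <-.
  by module_ring V.
Qed.

End KantorKoecherTits.

(** * Points and their stabilizers *)

Lemma generated_inverse (T : Type) (S : set (T -> T)) :
  (forall f, S f -> bijective f) ->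
  forall f, generated S f ->
    exists g, [/\ generated S g, cancel f g & cancel g f].
Proof.
move=> bijS f; elim=> {f} [|f Sf|f g _ [f' [Sf' fK Kf]] _ [g' [Sg' gK Kg]]|f g].
- by exists idfun; split=> //; exact: gen_id.
- by have [g fK gK] := bijS f Sf; exists g; split=> //; apply: gen_inv fK gK;
  exact: gen_mem.
- exists (g' \o f'); split; first exact: gen_comp.
    exact: can_comp.
  exact: can_comp.
- by move=> Sf _ fK gK; exists f; split.
Qed.

(** * Factorization of the parabolic subgroup P *)

Section LeviFactor.

Variables (K : comPzRingType) (V : jordanAlgType K).

Local Notation Q := (@jquad K V).
Local Notation D := (jpolar Q).
Local Notation theta := (@theta K V).
Local Notation trans := (@trans K V).
Local Notation ttrans := (@ttrans K V).

Let quadQ : forall x, quadratic_map (fun a => Q a x) := @jquad_quadratic K V.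

Lemma transK v : cancel (trans v) (trans (- v)).
Proof.
move=> z; rewrite -[LHS]/((trans (- v) \o trans v) z) trans_comp addNr.
by rewrite trans0.
Qed.

Lemma ttrans_comp v w : ttrans v \o ttrans w = ttrans (v + w).
Proof.
rewrite /ttrans -trans_comp; apply/funext => z /=; congr (theta (trans v _)).
exact: (congr1 (@^~ _) (thetaK V)).
Qed.

Lemma ttrans0 : ttrans 0 = idfun.
Proof. by rewrite /ttrans trans0; exact: thetaK. Qed.

Lemma ttransK v : cancel (ttrans v) (ttrans (- v)).
Proof.
move=> z; rewrite -[LHS]/((ttrans (- v) \o ttrans v) z) ttrans_comp addNr.
by rewrite ttrans0.
Qed.

Lemma theta_ttrans v : theta \o ttrans v = trans v \o theta.
Proof.
apply/funext => z; rewrite /ttrans /=.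
exact: (congr1 (@^~ _) (thetaK V)).
Qed.

Lemma levi_map_theta (y i : V) (h : jinverse_pair y i) :
  levi_map h \o theta = theta \o levi_map (jinverse_pair_sym h).
Proof.
apply: kkt_ext => u A B v z hz E.
by case: h (jinverse_pair_sym h) => ? ? ? [? ? ?]; rewrite /= E.
Qed.

Lemma levi_mapK (y i : V) (h : jinverse_pair y i) (h' : jinverse_pair i y) :
  cancel (levi_map h) (levi_map h').
Proof.
suff E : levi_map h' \o levi_map h = idfun.
  by move=> z; rewrite -[LHS]/((levi_map h' \o levi_map h) z) E.
apply: kkt_ext => u A B v z hz E; case: h h' => [QK KQ Qyi] [? ? ?].
rewrite /= E /= QK KQ.
by congr (_, (_, _), _); apply/funext => x /=; rewrite ?QK ?KQ.
Qed.

Lemma levi_map_trans (y i : V) (h : jinverse_pair y i) v :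
  levi_map h \o trans v = trans (Q y v) \o levi_map h.
Proof.
apply: kkt_ext => u A B w z hz E; case: h => QK KQ Qyi; rewrite /= E /= QK.
congr (_, (_, _), _).
- by rewrite (linearD (Q y)) (linearB (Q y)) /= jquad_fundamental KQ.
- apply/funext => x; rewrite -[LHS]/(Q y (A (Q i x) - D v w (Q i x))).
  rewrite -[RHS]/(Q y (A (Q i x)) - D (Q y v) (Q i w) x) linearB.
  by rewrite -[x in RHS](KQ x) jpolar_fundamental !KQ.
- apply/funext => x; rewrite -[LHS]/(Q i (B (Q y x) + D w v (Q y x))).
  rewrite -[RHS]/(Q i (B (Q y x)) + D (Q i w) (Q y v) x) linearD.
  by rewrite -[x in RHS](QK x) jpolar_fundamental !QK.
Qed.

Lemma levi_map_ttrans (y i : V) (h : jinverse_pair y i) v :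
  levi_map h \o ttrans v = ttrans (Q i v) \o levi_map h.
Proof.
apply/funext => z; rewrite /ttrans /=.
have TK x : theta (theta x) = x := congr1 (@^~ x) (thetaK V).
have LT x : levi_map h (theta x) = theta (levi_map (jinverse_pair_sym h) x).
  exact: (congr1 (@^~ x) (levi_map_theta h)).
rewrite LT; congr theta.
have := levi_map_trans (jinverse_pair_sym h) v.
move=> /(congr1 (@^~ (theta z))) /= ->.
by rewrite -[in RHS](TK z) LT TK.
Qed.

Lemma kkt_euler_subproof :
  ((0, (idfun, - idfun), 0) : kkt_ambient V) \in @kkt_set K V.
Proof.
rewrite inE /kkt_set /= -[(idfun, _)]scale1r.
by apply: module_span_gen; left.
Qed.

(** The element defining the 3-grading. Inner structure maps fix it, [ttrans] moves it along V^- and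
    [trans] along V^+, so its image tells these maps apart. *)
Definition kkt_euler : kkt V := SigSub kkt_euler_subproof.

Lemma trans_euler v : val (trans v kkt_euler) = (- v, (idfun, - idfun), 0).
Proof.
rewrite /= linear0 addr0 sub0r; congr (_, (_, _), _).
  by apply/funext => x; rewrite -[LHS]/(x - D v 0 x) jpolar0m subr0.
by apply/funext => x; rewrite -[LHS]/(- x + D 0 v x) (jpolar0l quadQ) addr0.
Qed.

Lemma ttrans_euler v : val (ttrans v kkt_euler) = (0, (idfun, - idfun), v).
Proof.
rewrite /= linear0 addr0 -[0 - _]/(0 - - v) sub0r opprK; congr (_, (_, _), _).
  by apply/funext => x; rewrite -[LHS]/(x + D 0 v x) (jpolar0l quadQ) addr0.
by apply/funext => x; rewrite -[LHS]/(- x - D v 0 x) jpolar0m subr0.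
Qed.

Lemma levi_map_euler (y i : V) (h : jinverse_pair y i) :
  levi_map h kkt_euler = kkt_euler.
Proof.
apply/val_inj; case: h => QK KQ Qyi; rewrite /= !linear0.
congr (_, (_, _), _); apply/funext => x; first exact: KQ.
by rewrite -[LHS]/(Q i (- Q y x)) linearN QK.
Qed.

Lemma trans_inj : injective trans.
Proof.
move=> v w /(congr1 (fun f => val (f kkt_euler))).
by rewrite !trans_euler => -[/oppr_inj].
Qed.

(* C will be the symmetric cone. *)
Variable C : set V.
Hypothesis C_quad : forall y i, jinverse_pair y i -> forall v, C v -> C (Q y v).

(** Properties of [levi_map] that survive composition. A product of operators Q_y need not be of the
    form Q_y, so elements of the inner structure group are handled through these properties. *)
Definition levi_half (f : kkt V -> kkt V) (S T : V -> V) :=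
  [/\ forall v, f \o trans v = trans (S v) \o f,
      forall v, f \o ttrans v = ttrans (T v) \o f,
      f kkt_euler = kkt_euler,
      f (theta kkt_euler) = theta kkt_euler &
      forall v, C v -> C (S v)].

(** The properties are required of the inverse too, which makes the class closed under inversion. *)
Definition levi (f : kkt V -> kkt V) := exists f' S S' T T',
  [/\ cancel f f', cancel f' f, levi_half f S T & levi_half f' S' T'].

Lemma levi_half_comp f g S T S' T' :
  levi_half f S T -> levi_half g S' T' ->
  levi_half (f \o g) (S \o S') (T \o T').
Proof.
move=> [fS fT fE fE' CS] [gS gT gE gE' CS']; split=> [v|v|||v Cv] /=.
- rewrite -[LHS]/(f \o (g \o trans v)) gS.
  by rewrite -[LHS]/((f \o trans (S' v)) \o g) fS.
- rewrite -[LHS]/(f \o (g \o ttrans v)) gT.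
  by rewrite -[LHS]/((f \o ttrans (T' v)) \o g) fT.
- by rewrite gE.
- by rewrite gE'.
- exact/CS/CS'.
Qed.

Lemma levi_map_half (y i : V) (h : jinverse_pair y i) :
  levi_half (levi_map h) (Q y) (Q i).
Proof.
split=> [v|v|||].
- exact: levi_map_trans.
- exact: levi_map_ttrans.
- exact: levi_map_euler.
- rewrite -[LHS]/((levi_map h \o theta) kkt_euler) levi_map_theta /=.
  by rewrite levi_map_euler.
- exact: C_quad h.
Qed.

Lemma inner_structure_map f : @inner_structure K V f ->
  exists y i (h : jinverse_pair y i), f = levi_map h.
Proof.
move=> [y [Qinv [QK KQ fE]]].
have QE : Q (Qinv y) = Qinv :> (V -> V).
  by apply/funext => z; exact: jquad_inv.
have h : jinverse_pair y (Qinv y) by split; rewrite ?QE.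
exists y, (Qinv y), h; apply/funext => z; apply/val_inj; rewrite fE.
by case: h => ? ? ?; rewrite /= QE.
Qed.

Lemma levi_comp f g : levi f -> levi g -> levi (f \o g).
Proof.
move=> [f' [S [S' [T [T' [fK Kf hf hf']]]]]].
move=> [g' [U [U' [W [W' [gK Kg hg hg']]]]]].
exists (g' \o f'), (S \o U), (U' \o S'), (T \o W), (W' \o T').
by split; [exact: can_comp|exact: can_comp|exact: levi_half_comp|
  exact: levi_half_comp].
Qed.

Lemma levi_inv f f' : levi f -> cancel f f' -> levi f'.
Proof.
move=> [g [S [S' [T [T' [fK Kf hf hf']]]]]] fK'.
have -> : f' = g by apply/funext => z; rewrite -[z in LHS]Kf fK'.
by exists f, S', S, T', T; split.
Qed.

Lemma generated_levi f : generated (@inner_structure K V) f -> levi f.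
Proof.
elim=> {f} [|f|f g _ lf _ lg|f g _ lf fK _].
- by exists idfun, idfun, idfun, idfun, idfun; split.
- move=> /inner_structure_map [y [i [h ->]]].
  exists (levi_map (jinverse_pair_sym h)), (Q y), (Q i), (Q i), (Q y).
  by split; [exact: levi_mapK|exact: levi_mapK|exact: levi_map_half|
    exact: levi_map_half].
- exact: levi_comp.
- exact: levi_inv lf fK.
Qed.

(** The factorization in a semidirect product: a Levi factor [f] normalizes the group of all
    [ttrans], so it moves to the right past [ttrans w'], turning w' into T w'. *)
Lemma parabolic_decomposition p : @geometry_parabolic K V p ->
  exists w f, [/\ levi f & p = ttrans w \o f].
Proof.
elim=> {p} [|p [[w _ <-]|ip]|p q _ [w [f [lf ->]]] _ [w' [f' [lf' ->]]]|p q _].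
- exists 0, idfun; split; last by rewrite ttrans0.
  exact/generated_levi/gen_id.
- by exists w, idfun; split=> //; exact/generated_levi/gen_id.
- exists 0, p; split; last by rewrite ttrans0.
  exact/generated_levi/gen_mem.
- have [k [S [S' [T [T' [_ _ [_ fT _ _ _] _]]]]]] := lf.
  exists (w + T w'), (f \o f'); split; first exact: levi_comp.
  rewrite -ttrans_comp.
  by rewrite -[LHS]/(ttrans w \o (f \o ttrans w') \o f') fT.
- move=> [w [f [lf ->]]] pK Kp.
  have [f' [S [S' [T [T' [fK Kf _ [_ f'T _ _ _]]]]]]] := lf.
  (* The inverse of ttrans w f is f' ttrans (-w) = ttrans (T' (-w)) f'. *)
  exists (T' (- w)), f'; split; first exact: levi_inv lf fK.
  rewrite -f'T; apply/funext => z; apply: (can_inj pK); rewrite Kp /= Kf.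
  by have := ttransK (- w); rewrite opprK => ->.
Qed.

End LeviFactor.

(** * The action on points of X *)

Section Points.

Variables (K : comPzRingType) (V : jordanAlgType K).

Local Notation Q := (@jquad K V).
Local Notation theta := (@theta K V).
Local Notation trans := (@trans K V).
Local Notation ttrans := (@ttrans K V).
Local Notation parabolic := (@geometry_parabolic K V).
Local Notation coset := (@left_coset K V).
Local Notation act := (@geometry_act K V).
Local Notation X := (jordan_geometry V).
Local Notation G := (geometry_group V).

Lemma thetaKfun : cancel theta theta.
Proof. by move=> z; rewrite -[LHS]/((theta \o theta) z) thetaK. Qed.

Lemma trans_bij v : bijective (trans v).
Proof.
exists (trans (- v)); first exact: transK.
by move=> z; have := transK (- v) z; rewrite opprK.
Qed.

Lemma ttrans_bij v : bijective (ttrans v).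
Proof.
exists (ttrans (- v)); first exact: ttransK.
by move=> z; have := ttransK (- v) z; rewrite opprK.
Qed.

Lemma parabolic_inverse p : parabolic p ->
  exists q, [/\ parabolic q, cancel p q & cancel q p].
Proof.
apply: generated_inverse => f [[v _ <-]|]; first exact: ttrans_bij.
move=> /inner_structure_map [y [i [h ->]]].
exists (levi_map (jinverse_pair_sym h)); exact: levi_mapK.
Qed.

Lemma group_inverse g : geometry_group V g ->
  exists h, [/\ geometry_group V h, cancel g h & cancel h g].
Proof.
apply: generated_inverse => f [[v _ <-]|[v _ <-]]; first exact: trans_bij.
exact: ttrans_bij.
Qed.

Lemma left_cosetP g h :
  coset g = coset h <-> exists2 p, parabolic p & h = g \o p.
Proof.
split=> [gh|[p pp ->]].
  have : coset h h by exists idfun => //; exact: gen_id.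
  by rewrite -gh => -[p pp <-]; exists p.
have [q [pq pK qK]] := parabolic_inverse pp.
apply/seteqP; split=> _ [r pr <-].
  exists (q \o r); first exact: gen_comp.
  by apply/funext => z /=; rewrite qK.
by exists (p \o r); first exact: gen_comp.
Qed.

Lemma val_act (g : G) (x : X) h :
  val x = coset h -> val (act g x) = coset (val g \o h).
Proof.
move=> xE; rewrite /= xE -[LHS]/((fun p => val g \o p) @` (_ @` _)).
by rewrite image_comp.
Qed.

Lemma val_affine v : val (affine_point v) = coset (trans v).
Proof. exact: val_act. Qed.

Lemma val_infinity : val (infinity V) = coset theta.
Proof. by rewrite /= weylE. Qed.

Lemma affine_point0 : affine_point 0 = origin V.
Proof. by apply/val_inj; rewrite val_affine trans0. Qed.

Lemma point_coset (x : X) : exists2 g, geometry_group V g & val x = coset g.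
Proof. by have [g hg <-] := set_valP x; exists g. Qed.

Definition group_mul (g h : G) : G :=
  SigSub (mem_set (gen_comp (set_valP g) (set_valP h))).

Lemma act_mul (g h : G) x : act (group_mul g h) x = act g (act h x).
Proof.
apply/val_inj; have [k _ xE] := point_coset x.
by rewrite (val_act _ xE) (val_act _ (val_act _ xE)).
Qed.

Definition group_trans (v : V) : G := SigSub (geometry_trans_subproof v).

Lemma geometry_theta_subproof : theta \in geometry_group V.
Proof. by rewrite -weylE; exact: geometry_weyl_subproof. Qed.

Definition group_theta : G := SigSub geometry_theta_subproof.

Lemma group_inv (g : G) : exists h : G, cancel (act g) (act h).
Proof.
have [h [hG gK hK]] := group_inverse (set_valP g).
exists (SigSub (mem_set hG)) => x; apply/val_inj.
have [k _ xE] := point_coset x.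
rewrite (val_act _ (val_act _ xE)) xE; congr coset.
by apply/funext => z /=; rewrite gK.
Qed.

Lemma act_inj (g : G) : injective (act g).
Proof. by have [h /can_inj] := group_inv g. Qed.

Lemma trans_affine v w :
  act (group_trans v) (affine_point w) = affine_point (v + w).
Proof.
by apply/val_inj; rewrite (val_act _ (val_affine w)) val_affine /= trans_comp.
Qed.

(** Moving [trans v] to the right past [theta] turns it into [ttrans v], which lies in P. *)
Lemma trans_infinity v : act (group_trans v) (infinity V) = infinity V.
Proof.
apply/val_inj; rewrite (val_act _ val_infinity) val_infinity /=.
rewrite -theta_ttrans; apply/esym/left_cosetP; exists (ttrans v) => //.
by apply: gen_mem; left; exists v.
Qed.

Lemma theta_infinity : act group_theta (infinity V) = origin V.
Proof.
by apply/val_inj; rewrite (val_act _ val_infinity) /= thetaK.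
Qed.

Lemma theta_origin : act group_theta (origin V) = infinity V.
Proof.
apply/val_inj; rewrite val_infinity.
by rewrite (@val_act _ _ idfun).
Qed.

Lemma theta_affine (y i : V) : jinverse_pair y i ->
  act group_theta (affine_point y) = affine_point (- i).
Proof.
move=> h; apply/val_inj; rewrite (val_act _ (val_affine y)) val_affine /=.
apply/esym/left_cosetP; exists (trans i \o theta \o trans y).
  rewrite (trans_theta_trans h); apply: gen_comp; apply: gen_mem.
    by left; exists (- y).
  by right; exact: inner_structure_levi.
apply/funext => z /=; have := transK i (theta (trans y z)).
by move=> ->.
Qed.

Lemma parabolic_euler p : parabolic p ->
  exists w, val (p (kkt_euler V)) = (0, (idfun, - idfun), w).
Proof.
(* The whole module is trivially stable under all operators [Q y]. *)
pose C : set V := setT.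
have hC (y i : V) : jinverse_pair y i -> forall v, C v -> C (Q y v) by [].
move=> /(parabolic_decomposition hC) [w [f [lf ->]]].
have [? [? [? [? [? [_ _ [_ _ fE _ _] _]]]]]] := lf.
by exists w; rewrite [(_ \o _) _]/= fE ttrans_euler.
Qed.

(** If v and w give the same coset, then t_(w - v) lies in P, so the V^+ component v - w of its
    value at the Euler element is 0. *)
Lemma affine_point_inj : injective (@affine_point K V).
Proof.
move=> v w /(congr1 val); rewrite !val_affine => /left_cosetP[p pp pE].
have [u uE] := parabolic_euler pp.
have E : trans (- v) \o trans w = p.
  by rewrite pE; apply/funext => z /=; rewrite transK.
have := trans_euler (- v + w); rewrite -trans_comp E uE => -[/esym/eqP].
by rewrite oppr_eq0 addrC subr_eq0 => /eqP.
Qed.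

(** Otherwise trans (-v) theta lies in P and preserves the L_0 component of the Euler element,
    whereas [theta] changes its sign; evaluation at e gives e + e = 0. *)
Lemma affine_neq_infinity v : (jone : V) + jone != 0 ->
  affine_point v != infinity V.
Proof.
apply: contra_neq => /(congr1 val).
rewrite val_affine val_infinity => /left_cosetP[p pp pE].
have [u uE] := parabolic_euler pp.
have E : trans (- v) \o theta = p.
  by rewrite pE; apply/funext => z /=; rewrite transK.
move: uE; rewrite -E /= => -[_ HA _ _].
have H : - jone - jpolar (@jquad K V) (- v) 0 jone = jone :> V.
  exact: (congr1 (fun f : V -> V => f jone) HA).
by rewrite -{1}H jpolar0m subr0 addNr.
Qed.

Variable C : set V.
Hypothesis C_quad : forall y i, jinverse_pair y i -> forall v, C v -> C (Q y v).

Lemma stabilizer_affine (g : G) x w :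
  act g (origin V) = origin V -> act g (infinity V) = infinity V ->
  act g x = affine_point w -> C w -> exists2 v, x = affine_point v & C v.
Proof.
move=> go goo gx Cw.
have gP : parabolic (val g).
  have /esym := congr1 val go; rewrite (@val_act g _ idfun)//.
  by move=> /left_cosetP[p pp pE]; have -> : val g = p := pE.
have [u [f [lf gE]]] := parabolic_decomposition C_quad gP.
have [f' [S [S' [T [T' [fK Kf [fS _ fE fE' CS] [f'S _ _ _ CS']]]]]]] := lf.
(* As g fixes infinity, theta g theta fixes the origin and so lies in P. It sends the Euler element
   to its image under [trans u], whose V^+ component - u must vanish. *)
have u0 : u = 0.
  have := congr1 val goo; rewrite (val_act _ val_infinity) val_infinity.
  move=> /esym/left_cosetP[p pp pE]; have [w' w'E] := parabolic_euler pp.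
  have E : theta \o (val g \o theta) = p.
    by rewrite pE; apply/funext => z /=; rewrite thetaKfun.
  have : p (kkt_euler V) = trans u (kkt_euler V).
    rewrite -E gE /= -[LHS]/((theta \o ttrans u) (f (theta (kkt_euler V)))).
    by rewrite theta_ttrans fE' /= thetaKfun.
  by move=> /(congr1 val); rewrite w'E trans_euler => -[/eqP];
    rewrite eq_sym oppr_eq0 => /eqP.
have gE' : val g = f by rewrite gE u0 ttrans0.
exists (S' w); last exact: CS'.
apply: (@act_inj g); rewrite gx; apply/val_inj.
rewrite (val_act _ (val_affine _)) val_affine gE' fS.
apply/left_cosetP; exists f; first by rewrite -gE'.
(* Conjugating [trans w] by f' and then by f changes nothing, so S (S' w) = w. *)
congr (trans _ \o f); apply: trans_inj.
apply/funext => z.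
rewrite -[in trans _ z](Kf z) -[LHS]/((trans (S (S' w)) \o f) (f' z)) -fS /=.
by rewrite -[trans (S' w) (f' z)]/((trans (S' w) \o f') z) -f'S /= Kf.
Qed.

End Points.

(** * Strictly ordered abelian groups *)

Section StrictOrderedZmodule.

Variable V : poZmodType.
Implicit Types a b c : V.

Lemma slt_irr a : ~ a <o a.
Proof. by move=> aa; exact: (slt_asym _ _ aa). Qed.

Lemma slt_subr_gt0 a b : 0 <o b - a <-> a <o b.
Proof.
split=> [/(slt_add2r _ _ a)|/(slt_add2r _ _ (- a))]; last by rewrite subrr.
by rewrite add0r subrK.
Qed.

Lemma sltN2 a b : - a <o - b <-> b <o a.
Proof.
have E : - b - - a = a - b by rewrite opprK addrC.
by split=> /slt_subr_gt0; rewrite ?E => h; apply/slt_subr_gt0; rewrite ?E.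
Qed.

Lemma slt_addr_gt0 a b : 0 <o a -> 0 <o b -> 0 <o a + b.
Proof.
move=> a0 b0; apply: slt_trans _ _ _ b0 _.
by rewrite -[X in X <o _]add0r; apply: slt_add2r.
Qed.

Lemma slt_add2l a b c : c + a <o c + b <-> a <o b.
Proof.
have E : c + b - (c + a) = b - a by rewrite [c + b]addrC opprD addrA addrK.
by split=> /slt_subr_gt0; rewrite ?E => h; apply/slt_subr_gt0; rewrite ?E.
Qed.

End StrictOrderedZmodule.

(** * The cyclic order *)

Section CyclicOrderTheory.

Variables (K : poRingType) (V : poJordanType K).

Local Notation X := (jordan_geometry V).
Local Notation o := (origin V).
Local Notation oo := (infinity V).
Local Notation act := (@geometry_act K V).
Local Notation R := (@cyclic_order K V).
Local Notation pt := (@affine_point K V).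

Lemma jone_addr_neq0 : (jone : V) + jone != 0.
Proof.
apply/eqP => ee0; apply: (@slt_irr V 0); rewrite -[X in _ <o X]ee0.
by apply: slt_addr_gt0; exact: poja_one_gt0.
Qed.

Lemma poja_quad_pair (y i : V) : jinverse_pair y i ->
  forall v, symmetric_cone V v -> symmetric_cone V (jquad y v).
Proof. by move=> /jinverse_pair_invertible yi v; exact: poja_quad_gt0. Qed.

(** Positivity follows from a^-1 = Q_(a^-1) a, since [Q i] preserves the cone. *)
Lemma gt0_inverse (a : V) : 0 <o a -> exists2 i, jinverse_pair a i & 0 <o i.
Proof.
move=> a0; have [i ai] := jinvertible_pair (poja_gt0_inv _ a0); exists i => //.
have [_ _ Qai] := jinverse_pair_sym ai; have [QK _ Qia] := ai.
rewrite -(jquad_invK QK Qia).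
exact: (poja_quad_pair (jinverse_pair_sym ai)).
Qed.

Lemma cyclic_order_act g a x b : R (act g a) (act g x) (act g b) -> R a x b.
Proof.
move=> [h [ha hb hx]]; exists (group_mul h g).
by rewrite !act_mul.
Qed.

Lemma act_cyclic_order g a x b : R a x b -> R (act g a) (act g x) (act g b).
Proof.
have [h hK] := group_inv g; move=> rab.
by apply: (@cyclic_order_act h); rewrite !hK.
Qed.

Lemma cyclic_order_origin_infinity x :
  R o x oo <-> exists2 w, x = pt w & 0 <o w.
Proof.
split=> [[g [go goo [w w0 gx]]]|[w -> w0]].
  exact: (stabilizer_affine poja_quad_pair go goo (esym gx)).
have E y : act (group_trans 0) y = y.
  have [g _ yE] := point_coset y.
  by apply/val_inj; rewrite (val_act _ yE) yE /= trans0.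
by exists (group_trans 0); rewrite !E; split=> //; exists w.
Qed.

Lemma cyclic_order_infinity u x :
  R (pt u) x oo <-> exists2 w, x = pt w & u <o w.
Proof.
have E : act (group_trans (- u)) (pt u) = o.
  by rewrite trans_affine addNr affine_point0.
split=> [/(act_cyclic_order (group_trans (- u)))|[w -> uw]].
  rewrite E trans_infinity => /cyclic_order_origin_infinity[w xw w0].
  exists (u + w); last by rewrite -[X in X <o _]addr0; apply/slt_add2l.
  by apply: (@act_inj _ _ (group_trans (- u))); rewrite xw trans_affine addKr.
apply: (@cyclic_order_act (group_trans (- u))).
rewrite E trans_infinity; apply/cyclic_order_origin_infinity.
exists (w - u); last exact/slt_subr_gt0.
by rewrite trans_affine addrC.
Qed.

(* t_(w^-1) o theta maps the triple (w, infinity, 0) to (0, w^-1, infinity). *)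
Lemma cyclic_order_rot a x b : R a x b -> R x b a.
Proof.
move=> [g [ga gb [w w0 gx]]]; apply: (@cyclic_order_act g).
rewrite ga gb -gx; have [i wi i0] := gt0_inverse w0.
apply: (@cyclic_order_act (group_theta V)).
rewrite (theta_affine wi) theta_infinity theta_origin -affine_point0.
apply/cyclic_order_infinity; exists 0 => //.
by rewrite -[X in _ <o X]oppr0; apply/sltN2.
Qed.

(** Rotating the triple would not show that x lies in V. Instead, with v translated to 0, [theta]
    maps (oo, x, 0) to a triple from o to oo whose middle point is some w > 0; so the translated x
    is - w^-1. *)
Lemma infinity_cyclic_order x v :
  R oo x (pt v) -> exists2 w, x = pt w & w <o v.
Proof.
move=> /(act_cyclic_order (group_trans (- v))).
rewrite trans_affine trans_infinity addNr affine_point0.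
move=> /(act_cyclic_order (group_theta V)); rewrite theta_infinity theta_origin.
move=> /cyclic_order_origin_infinity[w xw w0]; have [i wi i0] := gt0_inverse w0.
exists (v - i).
  apply: (@act_inj _ _ (group_trans (- v))); rewrite trans_affine addKr.
  apply: (@act_inj _ _ (group_theta V)).
  rewrite xw (theta_affine (jinverse_pairN (jinverse_pair_sym wi))).
  by rewrite opprK.
rewrite -[X in _ <o X]addr0; apply/slt_add2l.
by rewrite -[X in _ <o X]oppr0; apply/sltN2.
Qed.

(** With a moved to infinity and c to 0, the image of b lies below 0 and that of d above 0. *)
Lemma cyclic_order_trans a b c d : R a b c -> R a c d -> R a b d.
Proof.
move=> abc /cyclic_order_rot [g [gc ga [w w0 gd]]].
do 2 apply: cyclic_order_rot; apply: (@cyclic_order_act g).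
have := act_cyclic_order g abc; rewrite ga gc -affine_point0 -gd.
move=> /infinity_cyclic_order[w' -> w'0].
by apply/cyclic_order_infinity; exists w => //; exact: slt_trans _ _ _ w'0 w0.
Qed.

(** With a moved to 0 and c to infinity, the two triples would put b both above and below 0. *)
Lemma cyclic_order_asym a b c : R a b c -> ~ R c b a.
Proof.
move=> [g [ga gc [w w0 gb]]] /(act_cyclic_order g); rewrite ga gc -gb.
rewrite -affine_point0 => /infinity_cyclic_order[w' /affine_point_inj <-].
exact: slt_asym.
Qed.

Lemma cyclic_order_affine u x v : u <o v ->
  R (pt u) x (pt v) <-> exists w, [/\ x = pt w, u <o w & w <o v].
Proof.
move=> uv; have Ruv : R (pt u) (pt v) oo.
  by apply/cyclic_order_infinity; exists v.
split=> [uxv|[w [-> uw wv]]].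
  (* Transitivity yields the triple (u, x, oo), which also places x in V. *)
  have := cyclic_order_trans uxv Ruv.
  move=> /cyclic_order_infinity[w xw uw]; exists w; split=> //.
  (* Transitivity from v yields (v, oo, x), a rotation of (x, v, oo). *)
  have Rvu := cyclic_order_rot Ruv.
  have := cyclic_order_trans Rvu (cyclic_order_rot (cyclic_order_rot uxv)).
  move=> /cyclic_order_rot /cyclic_order_rot; rewrite xw.
  by move=> /cyclic_order_infinity[v' /affine_point_inj <-].
have Ruw : R (pt u) (pt w) oo by apply/cyclic_order_infinity; exists w.
have Rwv : R (pt w) (pt v) oo by apply/cyclic_order_infinity; exists v.
do 2 apply: cyclic_order_rot.
exact: cyclic_order_trans Rwv (cyclic_order_rot Ruw).
Qed.

Lemma transversal_affine u v : jinvertible (v - u) ->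
  transversal_pair (pt u) (pt v).
Proof.
move=> /jinvertible_pair[i vui].
(* This is t_u theta t_(-i) theta with i = (v - u)^-1. The origin goes through oo, oo and o to u;
   infinity goes through o, -i and v - u to v. *)
exists (group_mul (group_trans u) (group_mul (group_theta V)
  (group_mul (group_trans (- i)) (group_theta V)))).
rewrite !act_mul theta_origin theta_infinity trans_infinity theta_infinity.
rewrite -affine_point0 !trans_affine !addr0.
rewrite (theta_affine (jinverse_pairN (jinverse_pair_sym vui))) opprK.
by rewrite trans_affine addrCA subrr addr0.
Qed.

(** [theta] maps (o, x, c) to (oo, -i, -j), so only the inverses are compared; this reaches points x
    that are not comparable with o or c. *)
Lemma cyclic_order_inverse (x i c j : V) :
  jinverse_pair x i -> jinverse_pair c j -> j <o i -> R o (pt x) (pt c).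
Proof.
move=> xi cj ji; apply: (@cyclic_order_act (group_theta V)).
rewrite (theta_affine xi) (theta_affine cj) theta_origin.
do 2 apply: cyclic_order_rot; apply/cyclic_order_infinity.
by exists (- j) => //; apply/sltN2.
Qed.

End CyclicOrderTheory.

(** * Affine images of intervals *)

Section Intervals.

Variables (K : poRingType) (V : poJordanType K).

Local Notation oo := (infinity V).
Local Notation R := (@cyclic_order K V).
Local Notation pt := (@affine_point K V).

Lemma translated_cone (u x : V) :
  [set u + y | y in symmetric_cone V] x <-> u <o x.
Proof.
split=> [[y y0 <-]|ux].
  by rewrite -[X in X <o _]addr0; apply/slt_add2l.
by exists (x - u); [apply/slt_subr_gt0|rewrite addrC subrK].
Qed.

Lemma opposite_cone (v x : V) :
  [set v - y | y in symmetric_cone V] x <-> x <o v.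
Proof.
split=> [[y y0 <-]|xv].
  rewrite -[X in _ <o X]addr0; apply/slt_add2l.
  by rewrite -[X in _ <o X]oppr0; apply/sltN2.
by exists (v - x); [apply/slt_subr_gt0|rewrite opprD opprK addrA subrr add0r].
Qed.

Lemma convex_translated_cone (u : V) : convex_set [set x | u <o x].
Proof.
move=> a b t /= ua ub t0 t1.
have t0' : 0 <o 1 - t by apply/slt_subr_gt0.
have -> : u = (1 - t) *: u + t *: u by rewrite -scalerDl subrK scale1r.
apply: (slt_trans _ ((1 - t) *: a + t *: u)).
  exact/slt_add2r/pomod_scale2l.
exact/slt_add2l/pomod_scale2l.
Qed.

Lemma convex_opposite_cone (v : V) : convex_set [set x | x <o v].
Proof.
move=> a b t /= av bv t0 t1.
have t0' : 0 <o 1 - t by apply/slt_subr_gt0.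
have -> : v = (1 - t) *: v + t *: v by rewrite -scalerDl subrK scale1r.
apply: (slt_trans _ ((1 - t) *: v + t *: b)).
  exact/slt_add2r/pomod_scale2l.
exact/slt_add2l/pomod_scale2l.
Qed.

Lemma parabolic_interval (u : V) :
  cyclic_interval (pt u) oo = pt @` [set u + x | x in symmetric_cone V].
Proof.
apply/seteqP; split=> [x /cyclic_order_infinity[w -> uw]|x [w uw <-]].
  by exists w => //; apply/translated_cone.
by apply/cyclic_order_infinity; exists w => //; apply/translated_cone.
Qed.

Lemma parabolic_interval_opposite (v : V) :
  cyclic_interval oo (pt v) = pt @` [set v - x | x in symmetric_cone V].
Proof.
apply/seteqP; split=> [x /infinity_cyclic_order[w -> wv]|x [w wv <-]].
  by exists w => //; apply/opposite_cone.
do 2 apply: cyclic_order_rot; apply/cyclic_order_infinity.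
by exists v => //; apply/opposite_cone.
Qed.

Lemma elliptic_interval (u v : V) : u <o v ->
  cyclic_interval (pt u) (pt v) =
    pt @` ([set u + x | x in symmetric_cone V] `&`
           [set v - x | x in symmetric_cone V]).
Proof.
move=> uv; apply/seteqP; split=> [x /(cyclic_order_affine _ uv)|x].
  move=> [w [-> uw wv]]; exists w => //.
  by split; [apply/translated_cone|apply/opposite_cone].
move=> [w [/translated_cone uw /opposite_cone wv] <-].
by apply/(cyclic_order_affine _ uv); exists w.
Qed.

(** The triple (v, u, oo) combines with (u, x, oo) or with (x, v, oo): going from u to v through
    infinity, x lies before infinity in the first case and after it in the second. *)
Lemma hyperbolic_interval (u v x : V) : v <o u -> u <o x \/ x <o v ->
  R (pt u) (pt x) (pt v).
Proof.
have C (a b : V) : a <o b -> R (pt a) (pt b) oo.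
  by move=> ab; apply/cyclic_order_infinity; exists b.
move=> /C vu [/C ux|/C xv].
  exact: cyclic_order_trans ux (cyclic_order_rot vu).
apply: cyclic_order_rot.
exact: cyclic_order_trans vu (cyclic_order_rot xv).
Qed.

End Intervals.

(** * The example Q x Q *)

Section RegularJordan.

Variable K : comNzRingType.

Definition regular_quad (a : K^o) (x : K^o) : K^o := a * a * x.

Lemma regular_quad_linear a : linear (regular_quad a).
Proof. by move=> k x y; rewrite /regular_quad mulrDr -scalerAr. Qed.

HB.instance Definition _ a :=
  GRing.isLinear.Build K K^o K^o *:%R (regular_quad a) (regular_quad_linear a).

Definition regular_jquad (a : K^o) : {linear K^o -> K^o} := regular_quad a.

Lemma regular_jone_neq0 : (1 : K^o) != 0. Proof. exact: oner_neq0. Qed.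

Let square_zero_theory := sqz_ring_theory K^o.
Add Ring square_zero_ring : square_zero_theory.

Lemma regular_quadratic (x : K^o) : quadratic_map (fun a => regular_jquad a x).
Proof.
split=> [k a|b k a c]; rewrite /= /regular_quad -?[_ *: _]/(_ * _) ?expr2.
  by module_ring K^o.
by module_ring K^o.
Qed.

Section ScalarExtension.

Variables (A : comPzRingType) (phi : {rmorphism K -> A}) (W : lmodType A).
Variables (iota : {linear K^o -> W | phi \; *:%R}) (QW : W -> {linear W -> W}).

Let square_zero_theoryA := sqz_ring_theory A^o.
Add Ring square_zero_ringA : square_zero_theoryA.

Hypothesis extW : scalar_extension iota.
Hypothesis quadW : forall x, quadratic_map (fun a => QW a x).
Hypothesis QWE : forall a x, QW (iota a) (iota x) = iota (regular_jquad a x).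

(* Uniqueness in the universal property of W shows that iota 1 spans W. *)
Lemma regular_extension_coordinate : exists c : {linear W -> A^o},
  c (iota 1) = 1 /\ forall w, w = c w *: iota 1.
Proof.
have lphi : linear_for (phi \; *:%R) (phi : K^o -> A^o).
  by move=> k a b; rewrite rmorphD rmorphM.
pose mphi := GRing.isLinear.Build K K^o A^o (phi \; *:%R)
  (phi : K^o -> A^o) lphi.
pose f : {linear K^o -> A^o | phi \; *:%R} := HB.pack (phi : K^o -> A^o) mphi.
have [[c cE] _] := extW f.
have lh : linear (fun w => c w *: iota 1 : W).
  by move=> k a b; rewrite linearP scalerDl scalerA.
pose mh := GRing.isLinear.Build A W W *:%R (fun w => c w *: iota 1) lh.
pose h : {linear W -> W} := HB.pack (fun w : W => c w *: iota 1 : W) mh.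
have lid : linear (idfun : W -> W) by [].
pose mid := GRing.isLinear.Build A W W *:%R idfun lid.
pose i : {linear W -> W} := HB.pack (idfun : W -> W) mid.
have iotaE (k : K^o) : iota k = phi k *: iota 1.
  by rewrite -[in LHS](mulr1 k) -[k * 1]/(k *: (1 : K^o)) linearZ.
have [_ /(_ i h) U] := extW iota.
exists c; split=> [|w]; first by rewrite cE /= rmorph1.
by apply: U => k /=; rewrite cE iotaE.
Qed.

(** In the coordinate [c] the map [QW] becomes (a, x) |-> a^2 x on A, and the identities become
    polynomial identities in A. *)
Lemma regular_jordan_identities : jordan_identities (iota 1) QW.
Proof.
have [c [c1 cE]] := regular_extension_coordinate.
have QE a x : QW a x = (c a * c a * c x) *: iota 1.
  rewrite [a in LHS]cE [x in LHS]cE (jquadZ quadW) linearZ /= QWE /=.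
  by rewrite /regular_quad !mulr1 scalerA expr2.
have cQ a x : c (QW a x) = c a * c a * c x.
  by rewrite QE linearZ /= c1; exact: mulr1.
split=> [x|a b x|a x y].
- by rewrite QE c1 !mul1r -cE.
- by rewrite [LHS]cE [RHS]cE; congr (_ *: _); rewrite !cQ; module_ring A^o.
- have cD u v w : c (jpolar QW u v w) = c u * c v * c w + c u * c v * c w.
    by rewrite /jpolar !linearB /= !cQ linearD; module_ring A^o.
  rewrite [LHS]cE [RHS]cE; congr (_ *: _); rewrite cQ !cD cQ; module_ring A^o.
Qed.

End ScalarExtension.

HB.instance Definition _ := Lmodule_isJordan.Build K K^o
  regular_jone_neq0 regular_quadratic regular_jordan_identities.

Lemma regular_inverse (y i : K^o) : (y : K) * i = 1 -> jinverse_pair y i.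
Proof.
have KK (a b z : K) : a * b = 1 -> b * b * (a * a * z) = z.
  by move=> ab; rewrite mulrA mulrACA (mulrC b) ab mulr1 mul1r.
move=> yi; split=> [z|z|]; [exact: KK|by apply: KK; rewrite mulrC|].
by rewrite -[LHS]/((y : K) * y * i) -mulrA yi mulr1.
Qed.

End RegularJordan.

HB.instance Definition _ (R : poRingType) :=
  hasStrictOrder.Build R^o (@slt_asym R) (@slt_trans R).
HB.instance Definition _ (R : poRingType) :=
  Zmodule_isPoZmodule.Build R^o (@slt_add2r R).
HB.instance Definition _ (R : poRingType) :=
  Lmodule_isPoModule.Build R R^o (fun k a c => @poring_mul2l R a k c).

Section RatPair.

(** Strictness in both coordinates makes every positive element invertible. *)
Definition rat_pair_slt (a b : rat * rat) : Prop := (a.1 < b.1) && (a.2 < b.2).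

Lemma rat_pair_slt_asym a b : rat_pair_slt a b -> ~ rat_pair_slt b a.
Proof.
by move=> /andP[ab _] /andP[ba _]; have := lt_trans ab ba; rewrite ltxx.
Qed.

Lemma rat_pair_slt_trans a b c :
  rat_pair_slt a b -> rat_pair_slt b c -> rat_pair_slt a c.
Proof.
move=> /andP[ab1 ab2] /andP[bc1 bc2]; apply/andP.
by split; [exact: lt_trans bc1|exact: lt_trans bc2].
Qed.

HB.instance Definition _ := hasStrictOrder.Build (rat * rat)%type
  rat_pair_slt_asym rat_pair_slt_trans.

Lemma rat_pair_slt_add2r (a b c : rat * rat) : a <o b -> a + c <o b + c.
Proof. by move=> /andP[ab1 ab2]; apply/andP; rewrite /= !ltrD2r. Qed.

HB.instance Definition _ :=
  Zmodule_isPoZmodule.Build (rat * rat)%type rat_pair_slt_add2r.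

Lemma rat_pair_lt01 : (0 : rat * rat) <o 1. Proof. by []. Qed.

Lemma rat_pair_mul2l (a b c : rat * rat) :
  (0 : rat * rat) <o b -> a <o c -> b * a <o b * c.
Proof.
by move=> /andP[b1 b2] /andP[ac1 ac2]; apply/andP; rewrite /= !ltr_pM2l.
Qed.

HB.instance Definition _ :=
  ComNzRing_isPoRing.Build (rat * rat)%type rat_pair_lt01 rat_pair_mul2l.

(** The ring Q x Q is its own base ring here, so V is the regular Jordan algebra. *)
Local Notation V := ((rat * rat)^o)%type.

Lemma rat_pair_one_gt0 : (0 : V) <o jone. Proof. by []. Qed.

Lemma rat_pair_inv (y : V) : y.1 != 0 -> y.2 != 0 ->
  jinverse_pair y (y.1^-1, y.2^-1).
Proof.
case: y => y1 y2 /= y10 y20; apply: regular_inverse.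
by congr pair; rewrite /= divff.
Qed.

Lemma rat_pair_gt0_inv (a : V) : 0 <o a -> jinvertible a.
Proof.
move=> /andP[a1 a2]; have h : jinverse_pair a (a.1^-1, a.2^-1).
  by apply: rat_pair_inv; rewrite gt_eqF.
exact: (jinverse_pair_invertible h).
Qed.

Lemma rat_pair_quad_gt0 (a b : V) : jinvertible b -> 0 <o a -> 0 <o jquad b a.
Proof.
(* Evaluated at the unit, Q_b Q_i = id gives b^2 i^2 = 1, so neither coordinate of b is 0. *)
move=> /jinvertible_pair[i [_ /(_ jone) + _]] /andP[a1 a2].
rewrite -[jquad i jone]/(i * i * 1) -[jquad b _]/(b * b * _) => bi.
have b1 : b.1 != 0.
  apply/eqP => b0; have := congr1 fst bi.
  by rewrite /= b0 !mul0r => /eqP; rewrite eq_sym oner_eq0.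
have b2 : b.2 != 0.
  apply/eqP => b0; have := congr1 snd bi.
  by rewrite /= b0 !mul0r => /eqP; rewrite eq_sym oner_eq0.
have sq (x : rat) : x != 0 -> 0 < x * x.
  by move=> x0; rewrite -expr2 exprn_even_gt0.
apply/andP; split; [exact: (mulr_gt0 (sq _ b1) a1)|].
exact: (mulr_gt0 (sq _ b2) a2).
Qed.

HB.instance Definition _ := Jordan_isPoJordan.Build (rat * rat)%type V
  rat_pair_one_gt0 rat_pair_gt0_inv rat_pair_quad_gt0.

Let u : V := (1, 1).
Let v : V := (- 1, - 1).

Lemma rat_pair_transversal : transversal_pair (affine_point u) (affine_point v).
Proof.
apply/transversal_affine/jinverse_pair_invertible; exact: rat_pair_inv.
Qed.

Lemma rat_pair_lt : v <o u. Proof. by []. Qed.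

Lemma rat_pair_hyperbolic :
  affine_image (affine_point u) (affine_point v) (2, - 2).
Proof.
rewrite /affine_image /cyclic_interval /=.
(* Translation by -u gives the triple 0, (1, -3), (-2, -2). The last two have inverses (1, -1/3) and
   (-1/2, -1/2), and the second of these is smaller in both coordinates. *)
apply: (@cyclic_order_act _ _ (group_trans (- u))).
rewrite !trans_affine addNr affine_point0.
by apply: cyclic_order_inverse; [exact: rat_pair_inv|exact: rat_pair_inv|].
Qed.

Lemma rat_pair_infinity :
  ~ (cyclic_interval (affine_point u) (affine_point v) `<=`
     range (@affine_point (rat * rat)%type V)).
Proof.
move=> /(_ (infinity V)) [|w _ /eqP]; last first.
  by apply/negP/affine_neq_infinity/jone_addr_neq0.
by apply/cyclic_order_rot/cyclic_order_infinity; exists u.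
Qed.

Lemma rat_pair_not_convex :
  ~ convex_set (affine_image (affine_point u) (affine_point v)).
Proof.
have uv w : u <o w \/ w <o v ->
    affine_image (affine_point u) (affine_point v) w.
  exact: hyperbolic_interval.
have a2 : u <o ((2, 2) : V) by [].
have b2 : ((- 2, - 2) : V) <o v by [].
pose t : (rat * rat)%type := (2^-1, 2^-1).
have t0 : (0 : rat * rat) <o t by [].
have t1 : t <o 1 by [].
move=> /(_ _ _ t (uv _ (or_introl a2)) (uv _ (or_intror b2)) t0 t1).
(* The midpoint is 0, and v < 0 < u puts it into the interval from v to u, which is disjoint from
   that from u to v by asymmetry. *)
apply: cyclic_order_asym; apply/cyclic_order_affine => //.
by eexists; split; [reflexivity| |].
Qed.

End RatPair.

Theorem theorem4p5 :
  (forall (K : poRingType) (V : poJordanType K) (a b : jordan_geometry V),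
    transversal_pair a b ->
    [/\ (forall u : V, a = affine_point u -> b = infinity V ->
           cyclic_interval a b =
             affine_point @` [set u + x | x in symmetric_cone V])
        /\
        (forall v : V, b = affine_point v -> a = infinity V ->
           cyclic_interval a b =
             affine_point @` [set v - x | x in symmetric_cone V]),
        (forall u v : V, a = affine_point u -> b = affine_point v -> u <o v ->
           let S := [set u + x | x in symmetric_cone V] `&`
                    [set v - x | x in symmetric_cone V] in
           cyclic_interval a b = affine_point @` S /\ convex_set S)
      & (forall u v : V, a = affine_point u -> b = affine_point v -> v <o u ->
           [set u + x | x in symmetric_cone V] `|`
           [set v - x | x in symmetric_cone V] `<=` affine_image a b)])
  /\
  [/\ (exists (K : poRingType) (V : poJordanType K) (u v : V),
         [/\ transversal_pair (affine_point u) (affine_point v), v <o u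
           & affine_image (affine_point u) (affine_point v) <>
               [set u + x | x in symmetric_cone V] `|`
               [set v - x | x in symmetric_cone V]]),
      (exists (K : poRingType) (V : poJordanType K) (u v : V),
         [/\ transversal_pair (affine_point u) (affine_point v), ~ (u <o v)
           & ~ (cyclic_interval (affine_point u) (affine_point v) `<=`
                  range (@affine_point K V))])
    & (exists (K : poRingType) (V : poJordanType K) (u v : V),
         [/\ transversal_pair (affine_point u) (affine_point v), ~ (u <o v)
           & ~ convex_set (affine_image (affine_point u) (affine_point v))])].
Proof.
split=> [K V a b _|].
  split=> [|u v -> -> uv|u v -> -> vu x].
  - split=> [u -> ->|v -> ->]; first exact: parabolic_interval.
    exact: parabolic_interval_opposite.
  - split; first exact: elliptic_interval.
    move=> x y t [/translated_cone ux /opposite_cone xv].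
    move=> [/translated_cone uy /opposite_cone yv] t0 t1; split.
      exact/translated_cone/convex_translated_cone.
    exact/opposite_cone/convex_opposite_cone.
  - by move=> ux; apply: hyperbolic_interval => //;
    case: ux => [/translated_cone|/opposite_cone]; [left|right].
have nuv := slt_asym _ _ rat_pair_lt.
(* Unification with [rat_pair_transversal] supplies K, V, u and v. *)
split; do 4 eexists; split; try exact: rat_pair_transversal.
- exact: rat_pair_lt.
(* The point (2, -2) is neither above (1, 1) nor below (-1, -1). *)
- move=> E; have := rat_pair_hyperbolic; rewrite E.
  by move=> [/translated_cone|/opposite_cone].
- exact: nuv.
- exact: rat_pair_infinity.
- exact: nuv.
- exact: rat_pair_not_convex.
Qed.
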